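(* The function $\frac{3\log n}{n}$ is a sharp threshold for temporal connectivity. More specifically, for a random temporal graph $\mathcal G\sim\mathcal F_{n,p}$ with $p=p(n)\in[0,1]$: (i) if $p(n)<\frac{3\log n}{n}-\frac{6(\log n)^{0.8}}{n}$ for all sufficiently large $n$, then $\mathcal G$ is a.a.s. not temporally connected; (ii) if $p(n)>\frac{3\log n}{n}+\frac{3(\log n)^{0.8}}{n}$ for all sufficiently large $n$, then $\mathcal G$ is a.a.s. temporally connected.
   Context: A simple temporal graph is a pair $(G,\lambda)$ where $G=(V,E)$ is a finite simple undirected graph and $\lambda:E\to\mathbb R$ assigns a single time label to each edge. A temporal $(u,v)$-path is a path $u=u_0,\dots,u_\ell=v$ in $G$ with $\lambda(u_0u_1)\le\dots\le\lambda(u_{\ell-1}u_\ell)$. The temporal graph is temporally connected if for every ordered pair of distinct vertices $(u,v)$ there is a temporal $(u,v)$-path. For $n\in\mathbb N$ and $p\in[0,1]$, the model $\mathcal F_{n,p}$: draw $G$ from the Erdős–Rényi model $G_{n,p}$ on $n$ labelled vertices and give each edge of $G$ an independent time label uniform in $[0,1]$. $\log$ is the natural logarithm. A property holds a.a.s. if its probability tends to $1$ as $n\to\infty$. A function $p=p(n)$ is a sharp threshold for a property $\mathcal P$ if for every $\varepsilon>0$, a random temporal graph from $\mathcal F_{n,(1-\varepsilon)p}$ a.a.s. does not have $\mathcal P$, while one from $\mathcal F_{n,(1+\varepsilon)p}$ a.a.s. has $\mathcal P$. *)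

(* Defs.v *)
From HB Require Import structures.
From mathcomp Require Import all_boot all_order all_algebra.
From mathcomp Require Import all_classical all_reals all_analysis.

Set Implicit Arguments.
Unset Strict Implicit.
Unset Printing Implicit Defensive.

Import Order.TTheory GRing.Theory Num.Theory.
Import numFieldNormedType.Exports.

Local Open Scope classical_set_scope.
Local Open Scope ring_scope.

(* [tlabel] is total, but only its values on [tedges] are ever used. *)
Record temporal_graph (R : realType) (V : finType) := TemporalGraph {
  tedges : {set {set V}};
  tedges_card2 : forall e : {set V}, e \in tedges -> #|e| = 2%N;
  tlabel : {set V} -> R }.

Section TemporalConnectivity.
Context (R : realType) (V : finType).
Implicit Types (G : temporal_graph R V) (u v : V) (s : seq V).

Definition path_edges u s : seq {set V} :=
  pairmap (fun x y : V => [set x; y]%SET) u s.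

(* The path is u :: s. *)
Definition temporal_path G u v s : bool :=
  [&& uniq (u :: s), last u s == v,
      all (fun e => e \in tedges G) (path_edges u s)
    & sorted <=%R [seq tlabel G e | e <- path_edges u s]].

Definition temporally_connected G : Prop :=
  forall u v, u != v -> exists s, temporal_path G u v s.

End TemporalConnectivity.

Section ProductPower.
Context d (T : measurableType d) (R : realType).

Definition tuple_cons m (x : T * m.-tuple T) : m.+1.-tuple T :=
  [the m.+1.-tuple T of x.1 :: x.2].

Lemma measurable_tuple_cons m : measurable_fun setT (@tuple_cons m).
Proof. exact: measurable_cons. Qed.

HB.instance Definition _ m :=
  isMeasurableFun.Build _ _ _ _ (@tuple_cons m) (@measurable_tuple_cons m).

(* The m-fold product P \x ... \x P, i.e., the law of m iid draws from P. *)
Fixpoint iid (P : probability T R) (m : nat) : probability (m.-tuple T) R :=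
  if m is m'.+1 then distribution (P \x iid P m')%E (@tuple_cons m')
  else \d_[tuple].

End ProductPower.

Lemma measurable_box d (T : measurableType d) m (A : 'I_m -> set T) :
  (forall i, measurable (A i)) ->
  measurable [set t : m.-tuple T | forall i, A i (tnth t i)].
Proof.
move=> mA.
rewrite (_ : [set _ | _] =
         \big[setI/setT]_(i < m) ((@tnth _ T ^~ i) @^-1` A i)).
  apply: bigsetI_measurable => i _; rewrite -[X in measurable X]setTI.
  exact: measurable_tnth.
apply/seteqP; split => t /=.
  by move=> h; rewrite -bigcap_seq => i _; exact: h.
by rewrite -bigcap_seq => h i; apply: (h i); rewrite /= mem_index_enum.
Qed.

Lemma iid_boxE d (T : measurableType d) (R : realType) (P : probability T R)
    m (A : 'I_m -> set T) : (forall i, measurable (A i)) ->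
  iid P m [set t | forall i, A i (tnth t i)] = (\prod_(i < m) P (A i))%E.
Proof.
elim: m A => [|m IH] A mA.
  rewrite big_ord0 /= /dirac /= indicE mem_set//= => -[]//.
pose B i := A (lift ord0 i).
have mB i : measurable (B i) by exact: mA.
rewrite big_ord_recl -(IH B)// /= /distribution /pushforward.
rewrite -product_measure1E//; last exact: measurable_box.
congr (_ _); apply/seteqP; split => -[x t] /=.
  move=> h; split; first exact: (h ord0).
  by move=> i; have := h (lift ord0 i); rewrite tnthS.
move=> [h0 h] i; case: (unliftP ord0 i) => [j ->|->//].
by rewrite tnthS; exact: h.
Qed.

Section RandomTemporalGraph.
Context (R : realType) (n : nat).

Definition vpair : finType := {e : {set 'I_n} | #|e| == 2%N}.

(* An outcome tosses a coin and draws a label for every pair of vertices;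
   the labels drawn for the pairs that are not edges are discarded. *)
Definition outcome : Type :=
  (#|vpair|.-tuple bool * #|vpair|.-tuple (measurableTypeR R))%type.
HB.instance Definition _ := Measurable.on outcome.

Definition Fnp (p : R) : probability outcome R :=
  (iid (bernoulli_prob p) #|vpair| \x iid (uniform_prob (@ltr01 R)) #|vpair|)%E.

Definition outcome_edges (w : outcome) : {set {set 'I_n}} :=
  [set val e | e : vpair & tnth w.1 (enum_rank e)]%SET.

Lemma outcome_edges_card2 (w : outcome) (e : {set 'I_n}) :
  e \in outcome_edges w -> #|e| = 2%N.
Proof. by case/imsetP => x _ ->; apply/eqP; exact: valP x. Qed.

Definition outcome_label (w : outcome) (e : {set 'I_n}) : R :=
  if insub e is Some x then tnth w.2 (enum_rank (x : vpair)) else 0.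

Definition random_tgraph (w : outcome) : temporal_graph R 'I_n :=
  TemporalGraph (@outcome_edges_card2 w) (outcome_label w).

End RandomTemporalGraph.

Lemma measurable_edge_event (R : realType) n (e : {set 'I_n}) :
  measurable [set w : outcome R n | e \in outcome_edges w].
Proof.
case He : (insub e : option (vpair n)) => [x|]; last first.
  rewrite (_ : [set _ | _] = set0)//.
  apply/seteqP; split => w //= /imsetP[y _ ey].
  by move: He; rewrite ey valK.
have ex : e = val x by case: insubP He => // y _ <- [->].
pose f (w : outcome R n) := tnth w.1 (enum_rank x).
have mf : measurable_fun setT f.
  apply: (@measurableT_comp _ _ _ _ _ _
    (fun t : #|vpair n|.-tuple bool => tnth t (enum_rank x))) => //.
  exact: measurable_tnth.
rewrite (_ : [set _ | _] = setT `&` f @^-1` [set true]); first exact: mf.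
apply/seteqP; rewrite /f; split => w /=.
  by case/imsetP => y; rewrite inE => hy; rewrite ex => /val_inj ->.
by move=> [_ h]; rewrite ex; apply/imsetP; exists x; rewrite ?inE.
Qed.

Lemma measurable_outcome_label (R : realType) n (e : {set 'I_n}) :
  measurable_fun setT (fun w : outcome R n => outcome_label w e).
Proof.
rewrite /outcome_label; case: insub => [x|]; last exact: measurable_cst.
apply: (@measurableT_comp _ _ _ _ _ _ (fun t : #|vpair n|.-tuple
  (measurableTypeR R) => tnth t (enum_rank x))) => //.
exact: measurable_tnth.
Qed.

Lemma measurable_temporal_path (R : realType) n (u v : 'I_n) (s : seq 'I_n) :
  measurable [set w : outcome R n | temporal_path (random_tgraph w) u v s].
Proof.
have setb_and (p q : pred (outcome R n)) :
    [set w | p w && q w] = [set w | p w] `&` [set w | q w].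
  by apply/seteqP; split => w /=; [move/andP|move=> h; apply/andP].
have set_true : [set w : outcome R n | true] = setT by apply/seteqP; split.
have set_false : [set w : outcome R n | false] = set0.
  by apply/seteqP; split.
rewrite /temporal_path; case: (uniq _) => /=; last by rewrite set_false.
case: eqP => /= _; last by rewrite set_false.
move: (path_edges u s) => es; rewrite setb_and; apply: measurableI.
  elim: es => [|e es IH] /=; first by rewrite set_true.
  by rewrite setb_and; apply: measurableI => //; exact: measurable_edge_event.
elim: es => [|e [|e' es] IH] /=; rewrite ?set_true//.
rewrite setb_and; apply: measurableI => //.
rewrite -[X in measurable X]setTI.
by apply: measurable_fun_le => //; exact: measurable_outcome_label.
Qed.

(* The measure of a non-measurable set is meaningless; this event is fine. *)
Lemma measurable_temporally_connected (R : realType) n :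
  measurable [set w : outcome R n | temporally_connected (random_tgraph w)].
Proof.
pose F (uv : 'I_n * 'I_n) : set (outcome R n) :=
  if uv.1 != uv.2 then
    \bigcup_s [set w | temporal_path (random_tgraph w) uv.1 uv.2 s]
  else setT.
rewrite (_ : [set _ | _] = \bigcap_(uv in [set: 'I_n * 'I_n]) F uv).
  apply: fin_bigcap_measurable => //= -[u v] _; rewrite /F /=.
  case: ifP => // _; apply: countable_bigcupT_measurable => // s.
  exact: measurable_temporal_path.
apply/seteqP; split => w /=.
  move=> h [u v] _; rewrite /F /=; case: ifP => // uv.
  by have [s hs] := h _ _ uv; exists s.
move=> h u v uv; have := h (u, v) I.
by rewrite /F /= uv => -[s _ hs]; exists s.
Qed.

Section Thresholds.
Context (R : realType).
Implicit Types (p : nat -> R) (Q : forall n, temporal_graph R 'I_n -> Prop).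

(* Q holds a.a.s. for a random temporal graph drawn from F_{n, p n} *)
Definition aas p Q : Prop :=
  Fnp n (p n) [set w | Q n (random_tgraph w)] @[n --> \oo] --> 1%E.

(* (1 - eps) * p n and (1 + eps) * p n may fall outside [0, 1]. *)
Definition clamp01 (x : R) : R := Num.max 0 (Num.min 1 x).

Definition sharp_threshold p Q : Prop :=
  forall eps : R, 0 < eps ->
    aas (fun n => clamp01 ((1 - eps) * p n)) (fun n G => ~ Q n G) /\
    aas (fun n => clamp01 ((1 + eps) * p n)) Q.

End Thresholds.

(* Main.v *)
(** Rounding the labels to [N] equal cells turns the model into a finite product
    space: every pair of vertices is independently absent, with probability
    [1 - p], or in a given cell, with probability [p / N].

    Above the threshold, explore from a fixed source [u], cell after cell. As long
    as [k < n] vertices are reached, each of the [k (n - k)] crossing pairs is in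
    the next cell with conditional probability at least [q = p / N], because the
    past only tells that it avoided some earlier cells. For a potential [psi] with
    [psi (k + 1) = (1 - 1 / k) (1 - 1 / (n - k)) psi k], the expectation of
    [psi (number of reached vertices)] decays at rate about [p n] over the unit time
    interval, which bounds the probability of missing a vertex by about
    [n ^ 2 exp (- p n)]: this is [o(1 / n)] when [p n] is slightly above [3 log n],
    and a union bound over [u] concludes.

    Below the threshold, cut the time interval into thirds. By the second moment
    method, many vertices [u] have no edge in the first third and many vertices [v]
    none in the last third. A temporal path between two such vertices lives in the
    middle third, and the expected number of increasing paths between two given
    vertices there is at most [exp (n p / 3) / n = o(1)], even conditionally on [u]
    and [v] being of this kind; so Markov's inequality leaves a pair without a
    path. *)

Require Import Defs.
From mathcomp Require Import all_boot all_order all_algebra reals.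
From mathcomp Require Import ring lra zify.

Set Implicit Arguments.
Unset Strict Implicit.
Unset Printing Implicit Defensive.

Import Order.TTheory GRing.Theory Num.Theory.

Local Open Scope ring_scope.

(** * Exploration of a random graph *)

Section ProductWeight.
Context (R : realFieldType) (E S : finType).
Implicit Types (m : E -> S -> R) (f : {ffun E -> S}).

Definition weight m f : R := \prod_e m e (f e).

Lemma sum_weight m : \sum_f weight m f = \prod_e \sum_s m e s.
Proof. by rewrite bigA_distr_bigA. Qed.

Lemma weight_ge0 m f : (forall e s, 0 <= m e s) -> 0 <= weight m f.
Proof. by move=> m0; apply: prodr_ge0. Qed.

End ProductWeight.

Section Exploration.
Context (R : realFieldType) (V E S : finType) (ends : E -> {set V}).
Implicit Types (A : {set V}) (b : {set E}) (f : {ffun E -> S}) (m : E -> S -> R).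

Definition crossing A : {set E} :=
  [set e | (ends e :&: A != set0) && ~~ (ends e \subset A)].

Definition hits A s f : {set E} := [set e in crossing A | f e == s].

Definition absorb A b : {set V} := A :|: \bigcup_(e in b) ends e.

(** One hop per cell: edges of the same cell are never chained, so the cells along a path found this
    way strictly increase and rounding cannot hide a violation of the label order. *)
Definition explore A (ss : seq S) f : {set V} :=
  foldl (fun B s => absorb B (hits B s f)) A ss.

Lemma sub_absorb A b : A \subset absorb A b.
Proof. exact: subsetUl. Qed.

Lemma absorb0 A : absorb A set0 = A.
Proof. by rewrite /absorb big_set0 setU0. Qed.

Lemma card_absorb A b : b != set0 -> b \subset crossing A ->
  (#|A| < #|absorb A b|)%N.
Proof.
case/set0Pn => e eb /subsetP /(_ e eb); rewrite inE => /andP[_ /subsetPn[x xe xA]].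
apply: proper_card; apply/properP; split; first exact: sub_absorb.
by exists x => //; rewrite inE; apply/orP; right; apply/bigcupP; exists e.
Qed.

Lemma sub_explore A ss f : A \subset explore A ss f.
Proof.
elim: ss A => [|s ss IH] A //=; exact: subset_trans (sub_absorb _ _) (IH _).
Qed.

(** The masses conditioned on [hits A s f = b], left unnormalised. The condition is checked edge by
    edge, so the product form survives, with masses that now depend on the edge. *)
Definition reveal m A s b : E -> S -> R :=
  fun e x => m e x * ((e \in b) == (e \in crossing A) && (x == s))%:R.

Lemma weight_reveal m A s b f :
  weight (reveal m A s b) f = weight m f * (hits A s f == b)%:R.
Proof.
rewrite /weight big_split /=; congr (_ * _).
case: eqP => [<-|/eqP ne].
  by rewrite big1// => e _; rewrite inE eqxx.
have [e he] : exists e, (e \in hits A s f) != (e \in b).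
  apply/existsP; rewrite -negb_forall; apply: contra ne => /forallP h.
  by apply/eqP/setP => e; apply/eqP.
by rewrite (bigD1 e)//= eq_sym; move: he; rewrite inE => /negbTE ->; rewrite mul0r.
Qed.

Lemma sum_reveal m A s f : \sum_b weight (reveal m A s b) f = weight m f.
Proof.
under eq_bigr do rewrite weight_reveal.
by rewrite (bigD1 (hits A s f))//= eqxx mulr1 big1 ?addr0// => b;
  rewrite eq_sym => /negbTE ->; rewrite mulr0.
Qed.

Hypothesis card_crossing :
  forall A, (#|A| * (#|V| - #|A|) <= #|crossing A|)%N.

Variables (q rho : R) (psi : nat -> R).
Hypotheses (q01 : 0 <= q <= 1) (rho_ge0 : 0 <= rho).
Hypothesis psi_ge0 : forall k, 0 <= psi k.
Hypothesis psi_ge1 : forall k, (0 < k < #|V|)%N -> 1 <= psi k.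
Hypothesis psi_noninc : forall k l, (0 < k <= l)%N -> (l <= #|V|)%N ->
  psi l <= psi k.
Hypothesis psi_drift : forall k, (0 < k < #|V|)%N ->
  (1 - q) ^+ (k * (#|V| - k)) * (psi k - psi k.+1) + psi k.+1 <= rho * psi k.

(** Induction on the cells, for arbitrary masses so that the revealed ones can be fed back in.
    Invariant: an edge not inside [A] keeps at least a fraction [q] of its mass in each remaining
    cell. For an edge not inside the enlarged set, revealing a cell can only delete the mass of that
    cell, so the later fractions can only grow. [psi] dominates the failure indicator and shrinks on
    average by [rho] per cell. *)
Lemma explore_bound m A ss :
  (forall e s, 0 <= m e s) -> A != set0 -> uniq ss ->
  (forall e s, ~~ (ends e \subset A) -> s \in ss ->
     q * \sum_x m e x <= m e s) ->
  \sum_f weight m f * (explore A ss f != [set: V])%:R <=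
    rho ^+ size ss * psi #|A| * \prod_e \sum_s m e s.
Proof.
elim: ss m A => [|s ss IH] m A m0 A0 /=.
  move=> _ _; rewrite expr0 mul1r -sum_weight.
  have [->|AT] := eqVneq A [set: V].
    rewrite big1 => [|f _]; last by rewrite mulr0.
    by rewrite mulr_ge0// sumr_ge0// => f _; exact: weight_ge0.
  under eq_bigr do rewrite mulr1.
  rewrite ler_peMl ?sumr_ge0// => [f _|]; first exact: weight_ge0.
  apply: psi_ge1; rewrite card_gt0 A0 /= -cardsT.
  by apply: proper_card; rewrite properT.
move=> /andP[sss uss] mq.
have m1_ge0 e : 0 <= \sum_x m e x by apply: sumr_ge0.
have rm0 b e x : 0 <= reveal m A s b e x by rewrite mulr_ge0.
have [AT|AT] := eqVneq A [set: V].
  rewrite big1 => [|f _]; last first.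
    have := sub_explore (absorb A (hits A s f)) ss f; rewrite /absorb AT setTU.
    by rewrite subTset => /eqP ->; rewrite eqxx mulr0.
  by rewrite !mulr_ge0 ?exprn_ge0 ?prodr_ge0.
have kn : (0 < #|A| < #|V|)%N.
  by rewrite card_gt0 A0 /= -cardsT proper_card// properT.
set k := #|A| in kn *.
set W := \prod_e \sum_s m e s.
have W_ge0 : 0 <= W by apply: prodr_ge0.
pose Wb b := \prod_e \sum_x reveal m A s b e x.
have Wb_ge0 b : 0 <= Wb b by apply: prodr_ge0 => e _; apply: sumr_ge0.
have reveal_le e b : \sum_x reveal m A s b e x <= \sum_x m e x.
  by apply: ler_sum => x _; rewrite ler_piMr// lern1; case: (_ == _).
(* Split according to the revealed set [b]: on each part the next explored set is the fixed set
   [absorb A b], to which the induction hypothesis applies. *)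
have step1 : \sum_f weight m f * (explore (absorb A (hits A s f)) ss f != [set: V])%:R
    <= \sum_b rho ^+ size ss * psi #|absorb A b| * Wb b.
  rewrite (_ : \sum_f _ = \sum_b \sum_f weight (reveal m A s b) f *
      (explore (absorb A b) ss f != [set: V])%:R); last first.
    rewrite exchange_big /=; apply: eq_bigr => f _.
    rewrite (bigD1 (hits A s f))//= weight_reveal eqxx mulr1 big1 ?addr0// => b.
    by rewrite weight_reveal eq_sym => /negbTE ->; rewrite mulr0 mul0r.
  apply: ler_sum => b _; apply: IH => //.
    have [x xA] := set0Pn _ A0.
    by apply/set0Pn; exists x; apply: (subsetP (sub_absorb _ _)).
  move=> e t eA tss.
  have eA' : ~~ (ends e \subset A).
    by apply: contra eA => /subset_trans; apply; exact: sub_absorb.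
  have eb : e \notin b.
    apply: contra eA => eb; apply: (subset_trans _ (subsetUr _ _)).
    exact: (bigcup_sup e).
  have ts : t == s = false by apply: contraNF sss => /eqP <-.
  have -> : reveal m A s b e t = m e t.
    by rewrite /reveal ts andbF (negbTE eb) eqxx mulr1.
  apply: le_trans (mq e t eA' _); last by rewrite inE tss orbT.
  apply: ler_wpM2l; first by case/andP: q01.
  exact: reveal_le.
apply: (le_trans step1).
have sumWb : \sum_b Wb b = W.
  rewrite /Wb /W -sum_weight; under eq_bigr do rewrite -sum_weight.
  by rewrite exchange_big; apply: eq_bigr => f _; exact: sum_reveal.
(* Without any hit, every crossing edge loses its mass in cell [s], at least a fraction [q] of its
   total. *)
have W0 : Wb set0 <= (1 - q) ^+ #|crossing A| * W.
  rewrite -prodr_const big_mkcond /= -big_split /=; apply: ler_prod => e _.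
  rewrite sumr_ge0//=; case: ifPn => eA; last by rewrite mul1r.
  have /mq mqe : ~~ (ends e \subset A) by move: eA; rewrite inE => /andP[].
  rewrite mulrBl mul1r lerBrDr.
  apply: le_trans (lerD (lexx _) (mqe s (mem_head _ _))) _.
  rewrite (bigD1 s)//= [X in _ <= X](bigD1 s)//= [X in X + _ <= _]addrC.
  rewrite /reveal in_set0 eA eqxx /= mulr0 addr0 addrC lerD2r.
  by apply: ler_sum => x _; rewrite ler_piMr// lern1; case: (_ == _).
have dpsi : 0 <= psi k - psi k.+1.
  by rewrite subr_ge0 psi_noninc ?leqnSn ?andbT; case/andP: kn.
(* A hit gains a vertex, and since [psi] is nonincreasing the worst case is a gain of exactly one. A
   set [b] containing a non-crossing edge has mass zero. *)
have term b : psi #|absorb A b| * Wb b <=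
    psi k.+1 * Wb b + (b == set0)%:R * ((psi k - psi k.+1) * Wb set0).
  have [->|b0] := eqVneq b set0; first by rewrite absorb0 mul1r; lra.
  rewrite mul0r addr0; have [bA|bA] := boolP (b \subset crossing A).
    apply: ler_wpM2r => //; apply: psi_noninc; rewrite ?max_card//.
    exact: card_absorb.
  suff -> : Wb b = 0 by rewrite !mulr0.
  case/subsetPn: bA => e eb eA.
  rewrite /Wb (bigD1 e)//= big1 ?mul0r// => x _.
  by rewrite /reveal eb (negbTE eA) mulr0.
rewrite (_ : \sum_b _ = rho ^+ size ss * \sum_b psi #|absorb A b| * Wb b); last first.
  by rewrite mulr_sumr; apply: eq_bigr => b _; rewrite mulrA.
rewrite exprSr -!mulrA; apply: ler_wpM2l; first exact: exprn_ge0.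
apply: (le_trans (ler_sum _ (fun b _ => term b))).
rewrite big_split /= -mulr_sumr sumWb.
rewrite (bigD1 set0)//= eqxx mul1r big1 ?addr0; last first.
  by move=> b /negbTE ->; rewrite mul0r.
rewrite mulrA; apply: (@le_trans _ _ (((1 - q) ^+ (k * (#|V| - k)) * (psi k - psi k.+1)
   + psi k.+1) * W)); last by rewrite ler_wpM2r// psi_drift.
rewrite [leLHS]addrC [leRHS]mulrDl lerD2r [leRHS]mulrAC [leRHS]mulrC ler_wpM2l//.
apply: (le_trans W0); apply: ler_wpM2r => //.
by case/andP: q01 => q0 q1; apply: ler_wiXn2l; rewrite ?card_crossing//; lra.
Qed.

End Exploration.

(** * The potential and its drift *)

Section Potential.
Context (R : realFieldType) (n : nat) (eps : R).
Hypotheses (n3 : (3 <= n)%N) (e0 : 0 < eps) (e1 : eps < 1).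

(* For [k >= 2] the ratio of consecutive values is (1 - 1/k) (1 - 1/(n - k)),
   which is exactly 1 - (n - 1) / (k (n - k)). *)
Definition potential (k : nat) : R :=
  if (k <= 1)%N then (n - 2)%:R ^+ 2 / eps
  else (n - 2)%:R * (n - k)%:R / k.-1%:R.


Lemma potential_ge0 k : 0 <= potential k.
Proof.
rewrite /potential; case: ifP => _; last by rewrite divr_ge0 ?mulr_ge0.
by rewrite divr_ge0 ?exprn_ge0// ltW.
Qed.

Lemma potential1_ge : (n - 2)%:R ^+ 2 <= potential 1.
Proof. by rewrite /potential leqnn ler_pdivlMr// ler_piMr ?exprn_ge0// ltW. Qed.

Lemma potential_ge1 k : (0 < k < n)%N -> 1 <= potential k.
Proof.
move=> /andP[k0 kn]; have [k1|k2] := leqP k 1.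
  have -> : k = 1%N by lia.
  apply: le_trans potential1_ge.
  by rewrite exprn_ege1// ler1n; lia.
rewrite /potential leqNgt k2 /= ler_pdivlMr ?ltr0n; last by lia.
by rewrite mul1r -natrM ler_nat; nia.
Qed.

Lemma potential_noninc k l : (0 < k <= l)%N -> (l <= n)%N ->
  potential l <= potential k.
Proof.
move=> /andP[k0 kl] ln; have [k1|k2] := leqP k 1.
  have -> : k = 1%N by lia.
  have [l1|l2] := leqP l 1; first by have -> : l = 1%N by lia.
  apply: le_trans potential1_ge.
  rewrite /potential leqNgt l2 /= ler_pdivrMr ?ltr0n; last by lia.
  by rewrite -natrX -!natrM ler_nat; nia.
have -> : potential k = (n - 2)%:R * (n - k)%:R / k.-1%:R.
  by rewrite /potential leqNgt k2.
have -> : potential l = (n - 2)%:R * (n - l)%:R / l.-1%:R.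
  by rewrite /potential leqNgt (leq_trans k2 kl).
rewrite ler_pdivrMr ?ltr0n; last by lia.
rewrite mulrAC ler_pdivlMr ?ltr0n; last by lia.
rewrite -!natrM ler_nat -!mulnA leq_mul2l; apply/orP; right.
by apply: leq_mul; lia.
Qed.

Variable q : R.
Hypotheses (q0 : 0 <= q) (q1 : q <= 1).

(** Bounds the average shrinking of the potential per cell. The quotient [q' = q / (1 + q n^2)] is a
    slope for which [(1 - q)^m <= 1 - q' m] whenever [m <= n^2]. *)
Definition decay : R :=
  1 - q / (1 + q * n%:R ^+ 2) * n.-1%:R * (1 - eps).

Lemma decay_ge0 : 0 <= decay.
Proof.
have nn0 : 0 <= q * n%:R ^+ 2 by rewrite mulr_ge0 ?exprn_ge0.
rewrite subr_ge0; apply: (@le_trans _ _ (q / (1 + q * n%:R ^+ 2) * n.-1%:R)).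
  apply: ler_piMr; last by have := e0; lra.
  by rewrite !mulr_ge0 ?invr_ge0 ?addr_ge0//.
rewrite mulrAC ler_pdivrMr ?mul1r; last by lra.
have : q * n.-1%:R <= q * n%:R ^+ 2.
  by apply: ler_wpM2l => //; rewrite -natrX ler_nat; nia.
lra.
Qed.

(** Bernoulli's inequality for [(1 + q)^m], together with [(1 - q) (1 + q) <= 1]. *)
Lemma exprB1_le (m : nat) : (1 - q) ^+ m <= (1 + q * m%:R)^-1.
Proof.
have qm : 0 <= q * m%:R by rewrite mulr_ge0.
rewrite -[leRHS]mul1r ler_pdivlMr; last by lra.
apply: (@le_trans _ _ ((1 - q) ^+ m * (1 + q) ^+ m)).
  apply: ler_wpM2l; first by rewrite exprn_ge0// subr_ge0.
  elim: m {qm} => [|m IH]; first by rewrite mulr0 addr0 expr0.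
  rewrite exprS -natr1.
  have h : 0 <= q * m%:R * q by rewrite !mulr_ge0.
  have := ler_wpM2l (_ : 0 <= 1 + q) IH; rewrite addr_ge0// => /(_ isT); lra.
have qq : 0 <= q * q <= 1 by rewrite mulr_ge0 ?mulr_ile1.
by rewrite -exprMn exprn_ile1//; case/andP: qq => ? ?; lra.
Qed.

(** With [m = k (n - k)], a hit has chance at least [q' m], and for [k >= 2] the potential satisfies
    [m (psi k - psi (k + 1)) = (n - 1) psi k]: the relative drift does not depend on [k]. *)
Lemma potential_drift k : (0 < k < n)%N ->
  (1 - q) ^+ (k * (n - k)) * (potential k - potential k.+1) + potential k.+1
    <= decay * potential k.
Proof.
move=> /andP[k0 kn]; set m := (k * (n - k))%N.
have d0 : 0 <= potential k - potential k.+1.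
  by rewrite subr_ge0 potential_noninc ?leqnSn ?k0.
pose q' := q / (1 + q * n%:R ^+ 2).
have qn0 : 0 <= q * n%:R ^+ 2 by rewrite mulr_ge0 ?exprn_ge0.
have qm0 : 0 <= q * m%:R by rewrite mulr_ge0.
have q'0 : 0 <= q' by rewrite divr_ge0// addr_ge0.
have step : (1 - q) ^+ m <= 1 - q' * m%:R.
  apply: le_trans (exprB1_le m) _.
  rewrite -[leLHS]mul1r ler_pdivrMr; last by lra.
  have -> : (1 - q' * m%:R) * (1 + q * m%:R) = 
    1 + q * m%:R - q' * m%:R * (1 + q * m%:R) by ring.
  suff : q' * m%:R * (1 + q * m%:R) <= q * m%:R by lra.
  have -> : q' * m%:R * (1 + q * m%:R) =
    q * m%:R * (1 + q * m%:R) / (1 + q * n%:R ^+ 2) by rewrite /q'; ring.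
  rewrite ler_pdivrMr; last by lra.
  rewrite ler_wpM2l// lerD2l ler_wpM2l//.
  by rewrite -natrX ler_nat /m; nia.
apply: (@le_trans _ _ ((1 - q' * m%:R) * (potential k - potential k.+1)
   + potential k.+1)); first by rewrite lerD2r ler_wpM2r.
suff h : n.-1%:R * (1 - eps) * potential k <= m%:R * (potential k - potential k.+1).
  have := ler_wpM2l q'0 h; rewrite /decay -/q'; lra.
have [k1|k2] := leqP k 1.
  (* At [k = 1] the factor [1 - 1 / k] of the recursion vanishes. The finite value chosen there
     gives [potential 2 = eps * potential 1], a relative drop of [1 - eps]. *)
  have {k0 k1 d0 step qm0} k1 : k = 1%N by lia.
  have -> : m = n.-1 by rewrite /m; lia.
  rewrite k1 -mulrA ler_wpM2l// /potential /=.
  rewrite divr1 -expr2 mulrBl mul1r lerD2l lerN2.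
  by rewrite mulrC divfK// gt_eqF.
have -> : m%:R * (potential k - potential k.+1) = n.-1%:R * potential k.
  rewrite /potential ltnNge (ltnW k2) /= leqNgt k2 /=.
  have k10 : k.-1%:R != 0 :> R by rewrite pnatr_eq0; lia.
  have k1E : k%:R = k.-1%:R + 1 :> R by rewrite natr1 prednK.
  have kk0 : k.-1%:R + 1 != 0 :> R by rewrite -k1E pnatr_eq0; lia.
  have -> : n.-1%:R = k.-1%:R + (n - k)%:R :> R.
    by rewrite -natrD; congr (_%:R); lia.
  have -> : (n - k.+1)%:R = (n - k)%:R - 1 :> R.
    by rewrite -[in RHS](subnSK kn) -natr1 addrK.
  rewrite /m natrM k1E; field.
  by rewrite k10 kk0.
rewrite -mulrA ler_wpM2l// ler_piMl ?potential_ge0//; have := e0; lra.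
Qed.

End Potential.

Lemma explore_fail (R : realFieldType) (V E S : finType) (ends : E -> {set V})
    (mu : S -> R) (ss : seq S) (q eps : R) (u : V) :
  (forall A : {set V}, (#|A| * (#|V| - #|A|) <= #|crossing ends A|)%N) ->
  (3 <= #|V|)%N -> 0 < eps < 1 -> 0 <= q <= 1 ->
  (forall s, 0 <= mu s) -> \sum_s mu s = 1 -> uniq ss ->
  (forall s, s \in ss -> q <= mu s) ->
  \sum_f weight (fun=> mu) f * (explore ends [set u] ss f != [set: V])%:R <=
    decay #|V| eps q ^+ size ss * ((#|V| - 2)%:R ^+ 2 / eps).
Proof.
move=> cV V3 /andP[e0 e1] /[dup] q01 /andP[q0 q1] mu0 mu1 uss qmu.
have := @explore_bound R V E S ends cV q (decay #|V| eps q)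
  (potential #|V| eps) q01 _ _ _ _ _ (fun=> mu) [set u] ss (fun=> mu0) _ uss.
rewrite cards1 (_ : \prod_e _ = 1) ?mulr1; last by rewrite big1.
apply.
- exact: decay_ge0.
- by move=> k; exact: potential_ge0.
- by move=> k; exact: potential_ge1.
- by move=> k l; exact: potential_noninc.
- by move=> k; exact: potential_drift.
- by apply/set0Pn; exists u; rewrite inE.
- by move=> e s _ sss; rewrite mu1 mulr1 qmu.
Qed.

(** * The finite model *)

Section VertexPairs.
Context (n : nat).
Implicit Types (u v w x y : 'I_n) (A : {set 'I_n}) (e : vpair n).

Lemma vpair_ex x y : x != y -> exists e, val e = [set x; y].
Proof.
move=> xy; have h : #|[set x; y]| == 2 by rewrite cards2 xy.
by exists (Sub [set x; y] h).
Qed.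

(** An element of [A] and one of its complement form a crossing pair, and [A] tells which endpoint
    is which, so this map is injective. *)
Lemma card_crossing_vpair A :
  (#|A| * (#|'I_n| - #|A|) <= #|crossing (val : vpair n -> _) A|)%N.
Proof.
have -> : (#|'I_n| - #|A|)%N = #|~: A| by rewrite -(cardsC A) addKn.
rewrite -cardsX -(card_imset _ val_inj).
rewrite -(@card_in_imset _ _ (fun p : 'I_n * 'I_n => [set p.1; p.2])); last first.
  move=> [x y] [x' y']; rewrite !inE /= => /andP[xA yA] /andP[x'A y'A] /setP h.
  have /eqP -> : x == x'.
    have := h x; rewrite !inE eqxx /= => /esym/orP[//|/eqP xy'].
    by move: y'A; rewrite -xy' xA.
  have /eqP -> // : y == y'.
  have := h y; rewrite !inE eqxx orbT => /esym/orP[/eqP yx'|//].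
  by move: yA; rewrite yx' x'A.
apply: subset_leq_card; apply/subsetP => s /imsetP[[x y]].
rewrite inE /= => /andP[xA]; rewrite inE => yA ->.
have [|e ee] := @vpair_ex x y; first by apply: contraNneq yA => <-.
apply/imsetP; exists e => //; rewrite inE ee; apply/andP; split.
  by apply/set0Pn; exists x; rewrite !inE eqxx.
by apply/subsetPn; exists y => //; rewrite !inE eqxx orbT.
Qed.

Definition star u : {set vpair n} := [set e : vpair n | u \in val e].

Lemma starP u e : e \in star u -> exists2 w, w != u & val e = [set u; w].
Proof.
rewrite inE => ue; have /cards2P[x [y [xy exy]]] : #|val e| == 2 := valP e.
move: ue; rewrite exy !inE => /orP[/eqP ->|/eqP ->].
  by exists y; rewrite // eq_sym.
by exists x; rewrite // setUC.
Qed.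

Lemma card_star u : #|star u| = n.-1.
Proof.
rewrite -(card_imset _ val_inj).
have -> : val @: star u = [set [set u; w] | w in [set~ u]].
  apply/setP => s; apply/imsetP/imsetP => [[e /starP[w wu ew] ->]|[w]].
    by exists w; rewrite ?inE.
  rewrite !inE eq_sym => /vpair_ex[e ee] ->; exists e => //.
  by rewrite inE ee !inE eqxx.
rewrite card_in_imset ?cardsC1 ?card_ord// => x y; rewrite !inE => xu yu /setP.
by move=> /(_ x); rewrite !inE eqxx orbT (negbTE xu) => /esym/eqP.
Qed.

(** The two stars of [n - 1] pairs share only the pair joining their centres. *)
Lemma card_starU u v : u != v -> (2 * n - 3 <= #|star u :|: star v|)%N.
Proof.
move=> uv; rewrite cardsU !card_star.
suff : (#|star u :&: star v| <= 1)%N by lia.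
have [e0 e0E] := vpair_ex uv.
rewrite -(cards1 e0) subset_leq_card//; apply/subsetP => e.
rewrite !inE => /andP[ue ve]; apply/eqP; apply: val_inj; apply/esym/eqP.
rewrite eqEcard; apply/andP; split; last first.
  by rewrite (eqP (valP e)) (eqP (valP e0)).
by rewrite e0E; apply/subsetP => x; rewrite !inE => /orP[/eqP ->|/eqP ->].
Qed.

End VertexPairs.

(** * Expectation, Markov and Chebyshev inequalities on a finite product space *)

Section FiniteExpectation.
Context (R : realFieldType) (E S : finType) (mu : S -> R).
Hypotheses (mu_ge0 : forall s, 0 <= mu s) (mu_sum1 : \sum_s mu s = 1).
Implicit Types (X Y : {ffun E -> S} -> R) (P Q : pred {ffun E -> S}).

Definition expect X : R := \sum_f weight (fun=> mu) f * X f.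

Definition prob P : R := expect (fun f => (P f)%:R).

Lemma weight_mu_ge0 f : 0 <= weight (fun _ : E => mu) f.
Proof. exact: weight_ge0. Qed.

Lemma le_expect X Y : (forall f, X f <= Y f) -> expect X <= expect Y.
Proof. by move=> XY; apply: ler_sum => f _; rewrite ler_wpM2l// weight_mu_ge0. Qed.

Lemma expect_sum (I : Type) (r : seq I) (p : pred I) (X : I -> _) :
  expect (fun f => \sum_(i <- r | p i) X i f) = \sum_(i <- r | p i) expect (X i).
Proof.
rewrite /expect exchange_big /=; apply: eq_bigr => f _.
by rewrite mulr_sumr.
Qed.

Lemma expectD X Y : expect (fun f => X f + Y f) = expect X + expect Y.
Proof. by rewrite /expect -big_split; apply: eq_bigr => f _; rewrite mulrDr. Qed.

Lemma expectZ c X : expect (fun f => c * X f) = c * expect X.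
Proof. by rewrite /expect mulr_sumr; apply: eq_bigr => f _; rewrite mulrCA. Qed.

Lemma expect_cst c : expect (fun=> c) = c.
Proof.
by rewrite /expect -mulr_suml sum_weight big1 ?mul1r.
Qed.

(** Independence of the coordinates. *)
Lemma expect_prod (g : E -> S -> R) :
  expect (fun f => \prod_e g e (f e)) = \prod_e \sum_s mu s * g e s.
Proof. by rewrite bigA_distr_bigA; apply: eq_bigr => f _; rewrite -big_split. Qed.

Lemma le_prob P Q : (forall f, P f -> Q f) -> prob P <= prob Q.
Proof.
by move=> PQ; apply: le_expect => f; rewrite ler_nat; case: (P f) (PQ f) => // ->.
Qed.

Lemma prob_or P Q : prob (fun f => P f || Q f) <= prob P + prob Q.
Proof.
rewrite /prob -expectD; apply: le_expect => f; rewrite -natrD ler_nat.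
by case: (P f); case: (Q f).
Qed.

Lemma prob_exists (I : finType) (P : I -> pred {ffun E -> S}) :
  prob (fun f => [exists i, P i f]) <= \sum_i prob (P i).
Proof.
rewrite /prob -expect_sum; apply: le_expect => f; rewrite -natr_sum ler_nat.
case: existsP => // -[i Pi]; rewrite (bigD1 i)//= Pi; lia.
Qed.

Lemma markov X a : 0 < a -> (forall f, 0 <= X f) ->
  prob (fun f => a <= X f) <= expect X / a.
Proof.
move=> a0 X0; rewrite ler_pdivlMr// mulrC -expectZ; apply: le_expect => f.
by case: (leP a (X f)) => aX; rewrite ?mulr1 ?mulr0.
Qed.

(** Here [c] bounds the variance, and a value below half the mean deviates from it by at least
    [a / 2]. *)
Lemma chebyshev X a c : 0 < a -> expect X = a ->
  expect (fun f => X f ^+ 2) <= a ^+ 2 + c ->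
  prob (fun f => X f <= a / 2) <= 4 * c / a ^+ 2.
Proof.
move=> a0 EX EX2; have a20 : 0 < a ^+ 2 / 4 by rewrite divr_gt0 ?exprn_gt0.
apply: (@le_trans _ _ (prob (fun f => a ^+ 2 / 4 <= (X f - a) ^+ 2))).
  apply: le_prob => f Xf.
  (* The product equals [(X f - a)^2 - a^2 / 4]. *)
  suff : 0 <= (a / 2 - X f) * (3 * a / 2 - X f) by rewrite !expr2; lra.
  by apply: mulr_ge0; lra.
apply: le_trans (markov a20 _) _ => [f|]; first exact: sqr_ge0.
rewrite ler_pdivrMr// (_ : 4 * c / a ^+ 2 * (a ^+ 2 / 4) = c); last first.
  by field; rewrite gt_eqF.
have -> : expect (fun f => (X f - a) ^+ 2) =
    expect (fun f => X f ^+ 2 + ((- (2 * a)) * X f + a ^+ 2)).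
  by apply: eq_bigr => f _; congr (_ * _); rewrite !expr2; ring.
rewrite !expectD expectZ EX expect_cst expr2; move: EX2; rewrite expr2; lra.
Qed.

End FiniteExpectation.

(** * Vertices whose pairs all avoid a set of states *)

Section AvoidingVertices.
Context (R : realFieldType) (n : nat) (S : finType) (mu : S -> R).
Hypotheses (mu_ge0 : forall s, 0 <= mu s) (mu_sum1 : \sum_s mu s = 1).
Variables (D : {set S}).
Implicit Types (f : {ffun vpair n -> S}) (u v : 'I_n).

Definition avoids u f : bool := [forall e in star u, f e \notin D].

Definition avoid_mass : R := \sum_(s | s \notin D) mu s.

Definition nb_avoid f : R := \sum_(u : 'I_n) (avoids u f)%:R.

Lemma avoid_mass_ge0 : 0 <= avoid_mass.
Proof. exact: sumr_ge0. Qed.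

Lemma avoid_mass_le1 : avoid_mass <= 1.
Proof.
rewrite -mu_sum1 [leRHS](bigID (fun s => s \notin D)) /= lerDl.
exact: sumr_ge0.
Qed.

Lemma prob_avoid (F : {set vpair n}) :
  prob mu (fun f => [forall e in F, f e \notin D]) = avoid_mass ^+ #|F|.
Proof.
have -> : prob mu (fun f => [forall e in F, f e \notin D]) = expect mu (fun f =>
    \prod_e (if e \in F then (f e \notin D)%:R else 1)).
  apply: eq_bigr => f _; congr (_ * _); rewrite -big_mkcond /=.
  case: forall_inP => [h|].
    by rewrite big1// => e eF; rewrite h.
  move=> /forall_inP; rewrite negb_forall_in => /exists_inP[e eF fe].
  by rewrite (bigD1 e)//= (negbTE fe) mul0r.
rewrite (@expect_prod _ _ _ mu (fun e s => if e \in F then (s \notin D)%:R else 1)).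
rewrite -prodr_const [RHS]big_mkcond /=; apply: eq_bigr => e _.
case: ifP => _; last by under eq_bigr do rewrite mulr1.
rewrite /avoid_mass [RHS]big_mkcond /=; apply: eq_bigr => s _.
by case: (s \notin D); rewrite ?mulr1 ?mulr0.
Qed.

(** Second moment method. One vertex avoids [D] with probability [r^(n-1)], two distinct ones with
    probability at most [r^(2n-3)] because their stars share one pair. The second moment is thus at
    most [a + a^2 / r], and the variance at most [a + a^2 (1 / r - 1)]. *)
Lemma nb_avoid_concentration a : 0 < avoid_mass -> (2 <= n)%N ->
  a = n%:R * avoid_mass ^+ n.-1 ->
  prob mu (fun f => nb_avoid f <= a / 2) <=
    4 * (a^-1 + (avoid_mass^-1 - 1)).
Proof.
set r := avoid_mass => r0 n2 aE.
have a0 : 0 < a by rewrite aE mulr_gt0 ?exprn_gt0// ltr0n; lia.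
have Ea : expect mu nb_avoid = a.
  rewrite /nb_avoid expect_sum (eq_bigr (fun=> r ^+ n.-1)); last first.
    by move=> u _; rewrite -(card_star u); exact: prob_avoid.
  by rewrite sumr_const card_ord aE mulr_natl.
have -> : 4 * (a^-1 + (r^-1 - 1)) = 4 * (a + a ^+ 2 * (r^-1 - 1)) / a ^+ 2.
  by field; rewrite !gt_eqF.
apply: chebyshev => //.
have -> : expect mu (fun f => nb_avoid f ^+ 2) =
    \sum_u \sum_v prob mu (fun f => avoids u f && avoids v f).
  under eq_bigr do rewrite -expect_sum; rewrite -expect_sum.
  apply: eq_bigr => f _; congr (_ * _); rewrite expr2 /nb_avoid mulr_suml.
  apply: eq_bigr => u _; rewrite mulr_sumr; apply: eq_bigr => v _.
  by rewrite -natrM mulnb.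
have diag u : prob mu (fun f => avoids u f && avoids u f) = r ^+ n.-1.
  rewrite -(card_star u) -prob_avoid /prob /expect.
  by under eq_bigr do rewrite andbb.
have offdiag u v : u != v ->
    prob mu (fun f => avoids u f && avoids v f) <= r ^+ (2 * n - 3).
  move=> uv; apply: (@le_trans _ _ (r ^+ #|star u :|: star v|)).
    rewrite -prob_avoid; apply: le_prob => // f /andP[/forall_inP hu /forall_inP hv].
    by apply/forall_inP => e; rewrite inE => /orP[/hu|/hv].
  by apply: ler_wiXn2l; rewrite ?card_starU ?avoid_mass_ge0 ?avoid_mass_le1.
apply: (@le_trans _ _ (\sum_(u : 'I_n) (r ^+ n.-1 + \sum_(v : 'I_n) r ^+ (2 * n - 3)))).
  apply: ler_sum => u _; rewrite (bigD1 u)//= diag lerD2l.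
  apply: (@le_trans _ _ (\sum_(v | v != u) r ^+ (2 * n - 3))).
    by apply: ler_sum => v vu; apply: offdiag; rewrite eq_sym.
  rewrite [leRHS](bigID (fun v => v != u)) /= lerDl sumr_ge0// => v _.
  by rewrite exprn_ge0 ?avoid_mass_ge0.
rewrite !sumr_const card_ord -(mulr_natl (r ^+ (2 * n - 3))) -[leLHS]mulr_natl mulrDr.
have -> : r ^+ (2 * n - 3) = r ^+ n.-1 * r ^+ n.-1 / r.
  rewrite -exprD (_ : (n.-1 + n.-1 = (2 * n - 3).+1)%N); last by lia.
  by rewrite exprSr mulfK// gt_eqF.
have -> : n%:R * (n%:R * (r ^+ n.-1 * r ^+ n.-1 / r)) = a ^+ 2 / r.
  by rewrite aE !expr2; ring.
by rewrite -aE; lra.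
Qed.

End AvoidingVertices.

(** * Edges of a simple path *)

Section PathEdges.
Context (V : finType).
Implicit Types (u v x : V) (s : seq V) (e : {set V}).

Lemma path_edges_sub u s e x : e \in path_edges u s -> x \in e -> x \in u :: s.
Proof.
elim: s u => [|y s IH] u //=; rewrite inE => /orP[/eqP ->|es xe].
  by rewrite !inE => /orP[->//|->]; rewrite orbT.
by rewrite inE (IH y es xe) orbT.
Qed.

Lemma path_edges_card2 u s e : uniq (u :: s) -> e \in path_edges u s ->
  #|e| = 2.
Proof.
elim: s u => [|y s IH] u //= /andP[us ys]; rewrite inE => /orP[/eqP ->|].
  by rewrite cards2; move: us; rewrite inE negb_or => /andP[->].
exact: IH.
Qed.

Lemma path_edges_head u x s e : uniq (u :: x :: s) ->
  e \in path_edges u (x :: s) -> u \in e -> e = [set u; x].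
Proof.
move=> /= /andP[us _]; rewrite inE => /orP[/eqP //|es ue].
by rewrite (path_edges_sub es ue) in us.
Qed.

Lemma path_edges_rcons u s v :
  path_edges u (rcons s v) = rcons (path_edges u s) [set last u s; v].
Proof. by rewrite /path_edges -cats1 pairmap_cat /= cats1. Qed.

Lemma path_edges_last u s v e : uniq (u :: rcons s v) ->
  e \in path_edges u (rcons s v) -> v \in e -> e = [set last u s; v].
Proof.
rewrite path_edges_rcons mem_rcons inE -rcons_cons rcons_uniq => /andP[vs _].
by move=> /orP[/eqP //|es ve]; rewrite (path_edges_sub es ve) in vs.
Qed.

Lemma path_edges_uniq u s : uniq (u :: s) -> uniq (path_edges u s).
Proof.
elim: s u => [|y s IH] u //= /andP[us ys]; rewrite IH// andbT.
apply: contra us => /path_edges_sub; apply; rewrite !inE eqxx//.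
Qed.

End PathEdges.

(** * Probability of a prescribed path between avoiding endpoints *)

Section PathProbability.
Context (R : realFieldType) (n : nat) (S : finType) (mu : S -> R).
Hypotheses (mu_ge0 : forall s, 0 <= mu s) (mu_sum1 : \sum_s mu s = 1).
Implicit Types (f : {ffun vpair n -> S}) (u v : 'I_n).

(** The outer option tells whether a set is a pair of vertices at all. When [S] is itself an option
    type, a present edge reads [Some (Some i)]. *)
Definition states f (es : seq {set 'I_n}) : seq (option S) :=
  [seq omap f (insub e) | e <- es].

(** Each path edge costs a factor [q]. The endpoints' stars contain at least [2n - 3] pairs, at most
    two of them on the path; the remaining [2n - 5] or more still have to avoid [D1] or [D2], at a
    factor [r] each. *)
Lemma prob_path (D1 D2 : {set S}) (q r : R) u v (s : seq 'I_n) (ts : seq S) :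
  0 <= r <= 1 -> avoid_mass mu D1 <= r -> avoid_mass mu D2 <= r ->
  uniq (u :: rcons s v) -> size ts = (size s).+1 ->
  (forall x, x \in ts -> mu x <= q) ->
  prob mu (fun f => [&& avoids D1 u f, avoids D2 v f &
    states f (path_edges u (rcons s v)) == [seq Some x | x <- ts]]) <=
  q ^+ (size s).+1 * r ^+ (2 * n - 5).
Proof.
move=> /andP[r0 r1] rD1 rD2 us sts qts.
set PE := path_edges u (rcons s v).
have PEu : uniq PE by exact: path_edges_uniq.
have sPE : size PE = (size s).+1 by rewrite size_pairmap size_rcons.
have uv : u != v.
  by move: us => /=; rewrite mem_rcons inE negb_or => /andP[/andP[]].
have [x0 x0ts] : exists x, x \in ts.
  by case: (ts) sts => // x ts' _; exists x; rewrite mem_head.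
have q0 : 0 <= q by apply: le_trans (qts _ x0ts).
pose F := star u :|: star v.
pose PV := [set e : vpair n | val e \in PE].
(* One factor per pair, so that independence turns the expectation into a product: a prescribed
   state on the path, avoidance off it. *)
pose g (e : vpair n) (x : S) : R :=
  if e \in PV then (Some x == nth None [seq Some y | y <- ts] (index (val e) PE))%:R
  else (((e \in star u) ==> (x \notin D1)) && ((e \in star v) ==> (x \notin D2)))%:R.
apply: (@le_trans _ _ (expect mu (fun f => \prod_e g e (f e)))).
  apply: le_expect => // f.
  case: and3P => [[/forall_inP h1 /forall_inP h2 /eqP h3]|_]; last first.
    by apply: prodr_ge0 => e _; rewrite /g; case: ifP.
  rewrite big1// => e _; rewrite /g; case: ifPn => ePV.
    rewrite -h3 inE in ePV *; rewrite (nth_map set0) ?index_mem// nth_index//.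
    by rewrite valK /= eqxx.
  by case: (boolP (e \in star u)) => [/h1 ->|_];
     case: (boolP (e \in star v)) => [/h2 ->|_].
rewrite expect_prod.
apply: (@le_trans _ _ (\prod_e (if e \in PV then q else 1) *
    \prod_e (if e \in F :\: PV then r else 1))); last first.
  rewrite -!big_mkcond /= !prodr_const.
  have -> : #|PV| = (size s).+1.
    rewrite -(card_imset _ val_inj) -sPE.
    have -> : val @: PV = [set e in PE].
      apply/setP => e; apply/imsetP/idP => [[e' + ->]|]; rewrite !inE//.
      move=> ePE; have /eqP e2 := path_edges_card2 us ePE.
      by exists (Sub e e2); rewrite ?inE.
    by rewrite cardsE; exact/card_uniqP.
  rewrite ler_wpM2l ?exprn_ge0//; apply: ler_wiXn2l => //.
  have FU := card_starU uv; rewrite -/F -(cardsID PV F) in FU.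
  (* On a simple path only the first edge contains [u] and only the last contains [v]. *)
  suff : (#|F :&: PV| <= 2)%N by move: FU; set a := #|_|; set b := #|_|; lia.
  rewrite -(card_imset _ val_inj).
  have : (#|[set [set u; head v s]; [set last u s; v]]| <= 2)%N.
    by rewrite cards2; case: (_ != _).
  apply: leq_trans; apply: subset_leq_card; apply/subsetP => x /imsetP[e].
  rewrite !inE => /andP[uve ePE] ->; apply/orP.
  case/orP: uve => [ue|ve]; [left|right]; apply/eqP.
    by move: ePE us; rewrite /PE; case: (s) => [|y s'] ePE us;
      exact: path_edges_head us ePE ue.
  exact: path_edges_last ePE ve.
rewrite -big_split /=; apply: ler_prod => e _; apply/andP; split.
  by apply: sumr_ge0 => x _; rewrite mulr_ge0// /g; case: ifP.
rewrite !inE /g inE; case: ifPn => [ePE|ePE] /=.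
  rewrite mulr1 (nth_map x0) ?sts -?sPE ?index_mem//.
  set y := nth _ _ _; have yts : y \in ts by rewrite mem_nth// sts -sPE index_mem.
  rewrite (bigD1 y)//= eqxx mulr1 big1 ?addr0 ?qts// => x xy.
  by rewrite (inj_eq Some_inj) (negbTE xy) mulr0.
have le_mass (D : {set S}) (P : pred S) : avoid_mass mu D <= r ->
    (forall x, P x -> x \notin D) -> \sum_x mu x * (P x)%:R <= r.
  move=> rD PD; apply: le_trans rD; rewrite /avoid_mass [leRHS]big_mkcond /=.
  apply: ler_sum => x _; case: (boolP (P x)) => [/PD ->|_]; first by rewrite mulr1.
  by rewrite mulr0; case: ifP.
(* An off-path pair containing [u] is charged to [D1], even if it also contains [v]. *)
rewrite mul1r; case: (boolP (u \in val e)) => [ue|ue] /=.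
  by apply: (le_mass D1) => // x /andP[]; rewrite inE ue.
case: (boolP (v \in val e)) => [ve|ve] /=; last first.
  by under eq_bigr do rewrite !inE (negbTE ue) (negbTE ve) mulr1; rewrite mu_sum1.
by apply: (le_mass D2) => // x /andP[_]; rewrite inE ve.
Qed.

End PathProbability.

(** * The law of the state of one pair *)

Section StateMass.
Context (R : realFieldType) (K : nat) (p : R).

(** [None] stands for an absent pair, [Some i] for a present one with its label in cell [i]. *)
Definition state_mass (s : option 'I_K.+1) : R :=
  if s is Some _ then p / K.+1%:R else 1 - p.

Lemma state_mass_ge0 s : 0 <= p <= 1 -> 0 <= state_mass s.
Proof.
by move=> /andP[p0 p1]; case: s => [i|] /=; rewrite ?divr_ge0// subr_ge0.
Qed.

Definition before (m : nat) : {set option 'I_K.+1} :=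
  [set s : option 'I_K.+1 | if s is Some i then (i < m)%N else false].

Lemma state_mass_before m : (m <= K.+1)%N ->
  \sum_(s in before m) state_mass s = m%:R * (p / K.+1%:R).
Proof.
move=> mK; rewrite (reindex_omap (@Some 'I_K.+1) id); last first.
  by case=> // h; rewrite inE in h.
rewrite (eq_bigl (fun i : 'I_K.+1 => (i < m)%N)) => [|i]; last first.
  by rewrite /= eqxx andbT inE.
by rewrite (big_ord_narrow mK) /= sumr_const card_ord mulr_natl.
Qed.

Lemma state_mass_sum1 : \sum_s state_mass s = 1.
Proof.
rewrite (bigD1 None)//= (eq_bigl (fun s => s \in before K.+1)) => [|[i|]].
- rewrite state_mass_before// [K.+1%:R * _]mulrC divfK ?pnatr_eq0//.
  by rewrite subrK.
- by rewrite /= inE ltn_ord.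
- by rewrite /= inE.
Qed.

End StateMass.

(** * Paths inside the middle third *)

Section MiddlePaths.
Context (R : realFieldType) (n M : nat) (p : R).
Hypothesis p01 : 0 <= p <= 1.

(* The [3 * M.+1] cells split into three blocks of [M.+1] cells. *)
Let K := (3 * M).+2.
Let mu := @state_mass R K p.
Implicit Types (f : {ffun vpair n -> option 'I_K.+1}) (u v : 'I_n).

Definition early : {set option 'I_K.+1} := before K M.+1.

Definition late : {set option 'I_K.+1} :=
  [set s : option 'I_K.+1 | if s is Some i then (2 * M.+1 <= i)%N else false].

Definition mid_cell (i : 'I_M.+1) : 'I_K.+1 := inord (M.+1 + i).

Let mu_ge0 s : 0 <= mu s. Proof. exact: state_mass_ge0. Qed.
Let mu_sum1 : \sum_s mu s = 1. Proof. exact: state_mass_sum1. Qed.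
Let KE : K.+1%:R = 3 * M.+1%:R :> R.
Proof. by rewrite -natrM; congr (_%:R); rewrite /K; lia. Qed.
Let M0 : M.+1%:R != 0 :> R. Proof. by rewrite pnatr_eq0. Qed.

Lemma avoid_early : avoid_mass mu early = 1 - p / 3.
Proof.
have := mu_sum1; rewrite (bigID (fun s => s \in early)) /=.
rewrite state_mass_before ?KE; last by rewrite /K; lia.
rewrite -/(avoid_mass mu early).
have -> : M.+1%:R * (p / (3 * M.+1%:R)) = p / 3 by field; rewrite nat1r pnatr_eq0.
lra.
Qed.

Lemma avoid_late : avoid_mass mu late = 1 - p / 3.
Proof.
rewrite /avoid_mass (bigD1 None) ?inE//=.
rewrite (eq_bigl (fun s => s \in before K (2 * M.+1))) => [|[i|]]; last 2 first.
- by rewrite /= !inE -ltnNge andbT.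
- by rewrite /= !inE.
rewrite state_mass_before ?KE; last by rewrite /K; lia.
by rewrite natrM; field; rewrite nat1r pnatr_eq0.
Qed.

(** [l] counts the inner vertices, hence [l + 1] edges. The cells need only weakly increase, since
    successive labels of a temporal path may share a cell. *)
Definition mid_path u v f : bool :=
  [exists l : 'I_n, exists s : l.-tuple 'I_n, exists t : l.+1.-tuple 'I_M.+1,
    [&& uniq (u :: rcons s v), sorted leq [seq val i | i <- t] &
        states f (path_edges u (rcons s v)) ==
        [seq Some (Some (mid_cell i)) | i <- t]]].

(** Expected number of candidates: [n^l] choices of inner vertices, a stars-and-bars count of the
    weakly increasing sequences of [l + 1] cells among [M + 1], and a factor [p / (K + 1)] per
    edge. *)
Definition path_sum : R := \sum_(l < n) n%:R ^+ l *
  ('C(l.+1 + M, l.+1)%:R * (p / K.+1%:R) ^+ l.+1).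

Definition mid_good u v f : bool :=
  [&& avoids early u f, avoids late v f & mid_path u v f].

Lemma prob_mid_good u v :
  prob mu (mid_good u v) <= path_sum * (1 - p / 3) ^+ (2 * n - 5).
Proof.
have r01 : 0 <= 1 - p / 3 <= 1 by case/andP: p01 => p0 p1; apply/andP; split; lra.
have q0 : 0 <= p / K.+1%:R by case/andP: p01 => p0 p1; rewrite divr_ge0.
set r := 1 - p / 3 in r01 *; set q := p / K.+1%:R.
pose P l (s : l.-tuple 'I_n) (t : l.+1.-tuple 'I_M.+1) f : bool :=
  [&& uniq (u :: rcons s v), sorted leq [seq val i | i <- t] &
  [&& avoids early u f, avoids late v f & states f (path_edges u (rcons s v)) ==
        [seq Some (Some (mid_cell i)) | i <- t]]].
have step l (s : l.-tuple 'I_n) (t : l.+1.-tuple 'I_M.+1) :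
    prob mu (P l s t) <= (sorted leq [seq val i | i <- t])%:R *
      (q ^+ l.+1 * r ^+ (2 * n - 5)).
  have [us|us] := boolP (uniq (u :: rcons s v)); last first.
    apply: (@le_trans _ _ 0); last first.
      by case/andP: r01 => r0 _; rewrite !mulr_ge0 ?exprn_ge0.
    by rewrite /prob /expect big1// => f _; rewrite /P (negbTE us) mulr0.
  have [st|st] := boolP (sorted leq [seq val i | i <- t]); last first.
    by rewrite mul0r /prob /expect big1// => f _; rewrite /P (negbTE st) andbF mulr0.
  rewrite mul1r -[X in q ^+ X.+1](size_tuple s).
  have := @prob_path R n _ mu mu_ge0 mu_sum1 early late q r u v s
    [seq Some (mid_cell i) | i <- t] r01.
  rewrite avoid_early avoid_late lexx size_map !size_tuple => /(_ isT isT us erefl).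
  rewrite -map_comp => h; apply: le_trans (h _); last first.
    by move=> x /mapP[i _ ->].
  by apply: le_prob => // f /and3P[].
apply: (@le_trans _ _ (\sum_(l < n) \sum_(s : l.-tuple 'I_n)
    \sum_(t : l.+1.-tuple 'I_M.+1) prob mu (P l s t))).
  apply: (@le_trans _ _ (prob mu (fun f => [exists l : 'I_n,
      exists s : l.-tuple 'I_n, exists t : l.+1.-tuple 'I_M.+1, P l s t f]))).
    apply: le_prob => // f /and3P[a1 a2].
    move=> /existsP[l] /existsP[s] /existsP[t] /and3P[h1 h2 h3].
    apply/existsP; exists l; apply/existsP; exists s; apply/existsP; exists t.
    by rewrite /P h1 h2 a1 a2 h3.
  apply: le_trans (prob_exists _ _) _ => //; apply: ler_sum => l _.
  apply: le_trans (prob_exists _ _) _ => //; apply: ler_sum => s _.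
  exact: prob_exists.
rewrite /path_sum mulr_suml; apply: ler_sum => l _.
apply: (@le_trans _ _ (\sum_(s : l.-tuple 'I_n)
   ('C(l.+1 + M, l.+1)%:R * (q ^+ l.+1 * r ^+ (2 * n - 5))))).
  apply: ler_sum => s _; apply: le_trans (ler_sum _ (fun t _ => step l s t)) _.
  rewrite -mulr_suml -natr_sum -(card_sorted_tuples l.+1 M).
  by rewrite -sum1dep_card [in leRHS]big_mkcond lexx.
by rewrite sumr_const card_tuple card_ord -[leLHS]mulr_natl natrX !mulrA.
Qed.

Definition all_mid_paths f : bool :=
  [forall u, forall v, [&& u != v, avoids early u f & avoids late v f]
     ==> mid_path u v f].

(** Outside two Chebyshev events, more than [a / 2] vertices avoid the early cells and more than
    [a / 2] the late ones. If all such pairs had middle paths, the number [Y] of good pairs would be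
    at least [a^2 / 8], while its mean is at most [a^2 * path_sum / r^3]; Markov's inequality bounds
    this last case. *)
Lemma prob_all_mid_paths a : (3 <= n)%N -> a = n%:R * (1 - p / 3) ^+ n.-1 ->
  4 <= a ->
  prob mu all_mid_paths <= 8 * (a^-1 + ((1 - p / 3)^-1 - 1))
    + 8 * path_sum / (1 - p / 3) ^+ 3.
Proof.
move=> n3 aE a4; set r := 1 - p / 3 in aE *.
have r0 : 0 < r by case/andP: p01 => p0 p1; rewrite /r; lra.
have n2 : (2 <= n)%N by lia.
pose Y f : R := \sum_u \sum_(v | v != u) (mid_good u v f)%:R.
have a0 : 0 < a by lra.
have h1 : prob mu (fun f => nb_avoid R early f <= a / 2) <= 4 * (a^-1 + (r^-1 - 1)).
  rewrite /r -avoid_early; apply: nb_avoid_concentration; rewrite // avoid_early//.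
have h2 : prob mu (fun f => nb_avoid R late f <= a / 2) <= 4 * (a^-1 + (r^-1 - 1)).
  rewrite /r -avoid_late; apply: nb_avoid_concentration; rewrite // avoid_late//.
have a80 : 0 < a ^+ 2 / 8 by rewrite divr_gt0// exprn_gt0.
have h3 : prob mu (fun f => a ^+ 2 / 8 <= Y f) <= 8 * path_sum / r ^+ 3.
  apply: le_trans (markov _ a80 _) _ => // [f|].
    by apply: sumr_ge0 => u _; apply: sumr_ge0.
  have EY : expect mu Y <= n%:R ^+ 2 * (path_sum * r ^+ (2 * n - 5)).
    rewrite /Y expect_sum; apply: (@le_trans _ _ (\sum_(u : 'I_n) \sum_(v : 'I_n)
        (path_sum * r ^+ (2 * n - 5)))); last first.
      set B := path_sum * _; rewrite !sumr_const !card_ord -(mulr_natl B).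
      by rewrite -(mulr_natl (_ * B)) expr2 mulrA.
    apply: ler_sum => u _; rewrite expect_sum [leRHS](bigID (fun v => v != u)) /=.
    rewrite -[leLHS]addr0 lerD//; first by apply: ler_sum => v _; exact: prob_mid_good.
    apply: sumr_ge0 => v _; apply: mulr_ge0; last by rewrite exprn_ge0// ltW.
    apply: sumr_ge0 => l _; rewrite !mulr_ge0 ?exprn_ge0 ?divr_ge0//.
    by case/andP: p01.
  rewrite ler_pdivrMr//; apply: (le_trans EY).
  have -> : r ^+ (2 * n - 5) = r ^+ n.-1 * r ^+ n.-1 / r ^+ 3.
    rewrite -exprD (_ : (n.-1 + n.-1 = (2 * n - 5) + 3)%N); last by lia.
    by rewrite exprD mulfK// expf_neq0// gt_eqF.
  rewrite aE le_eqVlt; apply/orP; left; apply/eqP.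
  by field; rewrite gt_eqF.
have -> : 8 * (a^-1 + (r^-1 - 1)) + 8 * path_sum / r ^+ 3 =
  4 * (a^-1 + (r^-1 - 1)) + (4 * (a^-1 + (r^-1 - 1)) + 8 * path_sum / r ^+ 3) by ring.
apply: le_trans (lerD h1 (lerD h2 h3)).
apply: le_trans (lerD (lexx _) (prob_or _ _ _)) => //.
apply: le_trans (prob_or _ _ _) => //.
apply: le_prob => // f /forallP hf.
case: (leP (nb_avoid R early f) (a / 2)) => //= U1.
case: (leP (nb_avoid R late f) (a / 2)) => //= U2.
set U := nb_avoid R early f in U1; set V := nb_avoid R late f in U2.
(* A vertex may avoid both thirds, so each [u] is certain of only [V - 1] partners. With
   [U, V > a / 2], the condition [4 <= a] gives [a / 2 * (a / 2 - 1) >= a^2 / 8]. *)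
apply: (@le_trans _ _ (U * (V - 1))).
  have : 0 <= (U - a / 2) * (V - 1) by apply: mulr_ge0; lra.
  have : 0 <= a / 2 * (V - a / 2) by apply: mulr_ge0; lra.
  have : 0 <= a * (a - 4) by apply: mulr_ge0; lra.
  rewrite expr2; lra.
rewrite mulrBr mulr1 lerBlDr /Y /U /V /nb_avoid -big_split /= mulr_suml.
apply: ler_sum => u _; rewrite mulr_sumr (bigD1 u)//= addrC lerD//.
  apply: ler_sum => v vu; rewrite -natrM ler_nat mulnb /mid_good.
  case: (boolP (_ && _)) => // /andP[a1 a2]; rewrite a1 a2 /=.
  by have /forallP/(_ v)/implyP -> := hf u; rewrite // eq_sym vu a1 a2.
by rewrite ler_piMr// lern1; case: (avoids _ _ _).
Qed.

End MiddlePaths.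

(** * Temporal paths and their coarsening *)

Section Coarsening.
Context (R : realType) (n : nat).
Implicit Types (u v : 'I_n).

(** The deterministic link between a temporal graph and a finite outcome; the path arguments below
    rely on it without any probability. *)
Definition coarsening K (c : R -> 'I_K.+1) (G : temporal_graph R 'I_n)
    (f : {ffun vpair n -> option 'I_K.+1}) : Prop :=
  [/\ forall x y, x <= y -> (c x <= c y)%N,
      forall e : vpair n, (val e \in tedges G) = isSome (f e) &
      forall (e : vpair n) i, f e = Some i -> c (tlabel G (val e)) = i].

Section Reached.
Variables (K : nat) (c : R -> 'I_K.+1) (G : temporal_graph R 'I_n).
Variables (f : {ffun vpair n -> option 'I_K.+1}) (u : 'I_n).
Hypothesis cG : coarsening c G f.

(** Paths stay inside [A], so appending a vertex outside [A] keeps them simple; their cells stay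
    below [k], so appending an edge of cell at least [k] keeps the labels sorted. *)
Let reached (A : {set 'I_n}) (k : nat) : Prop := forall v, v \in A ->
  exists s, [/\ temporal_path G u v s, {subset u :: s <= A} &
    {in path_edges u s, forall e, (c (tlabel G e) < k)%N}].

Let reached_step (A : {set 'I_n}) (i : 'I_K.+1) : reached A i ->
  reached (absorb val A (hits val A (Some i) f)) i.+1.
Proof.
case: cG => c_homo edgeP labelP hA v; rewrite inE.
have [vA _|vA /= /bigcupP[e]] := boolP (v \in A).
  have [s [h1 h2 h3]] := hA v vA; exists s; split => //.
    by move=> x /h2 xA; rewrite inE xA.
  by move=> e /h3; exact: ltnW.
rewrite !inE => /andP[/andP[/set0Pn[x]]]; rewrite inE => /andP[xe xA] _ /eqP fe ve.
have xv : x != v by apply: contraNneq vA => <-.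
have eE : val e = [set x; v].
  apply/esym/eqP; rewrite eqEcard cards2 xv (eqP (valP e)) andbT.
  by apply/subsetP => y; rewrite !inE => /orP[/eqP ->|/eqP ->].
have [s [/and4P[us /eqP ls es ss] sA sk]] := hA x xA.
have eG : val e \in tedges G by rewrite edgeP fe.
have ce := labelP _ _ fe.
have PE : path_edges u (rcons s v) = rcons (path_edges u s) (val e).
  by rewrite path_edges_rcons ls eE.
exists (rcons s v); split.
- apply/and4P; split.
  + by rewrite -rcons_cons rcons_uniq us andbT; apply: contra vA => /sA.
  + by rewrite last_rcons.
  + by rewrite PE all_rcons eG.
  + rewrite PE map_rcons sorted_pairwise; last exact: le_trans.
    rewrite pairwise_rcons -sorted_pairwise ?ss ?andbT; last exact: le_trans.
    (* An earlier edge lies in a strictly smaller cell, so a larger label on it would contradict the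
       monotonicity of [c]. *)
    apply/allP => _ /mapP[e' /sk e'k ->]; rewrite leNgt; apply/negP => /ltW/c_homo.
    by rewrite ce; lia.
- move=> y; rewrite -rcons_cons mem_rcons inE => /orP[/eqP ->|/sA yA].
    rewrite inE; apply/orP; right; apply/bigcupP; exists e => //.
    rewrite !inE fe eqxx andbT; apply/andP; split.
      by apply/set0Pn; exists x; rewrite inE xe.
    by apply/subsetPn; exists v.
  by rewrite inE yA.
- move=> e'; rewrite PE mem_rcons inE => /orP[/eqP ->|/sk /ltnW//].
  by rewrite ce.
Qed.

Lemma explore_temporal_path v :
  explore val [set u] [seq Some i | i <- enum 'I_K.+1] f = [set: 'I_n] ->
  exists s, temporal_path G u v s.
Proof.
(* Generalised to any increasing list of remaining cells, all at least [k]; the bound [k] is raised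
   to the current cell before each step. *)
have H (l : seq 'I_K.+1) A k : reached A k -> sorted ltn [seq val i | i <- l] ->
    {in l, forall i : 'I_K.+1, (k <= i)%N} ->
    exists k', reached (explore val A [seq Some i | i <- l] f) k'.
  elim: l A k => [|i l IH] A k hA; first by exists k.
  move=> /= il kl; apply: (IH _ i.+1).
  - apply: reached_step => v' /hA[s [h1 h2 h3]]; exists s; split => // e /h3 h.
    by apply: leq_trans h _; apply: kl; rewrite mem_head.
  - exact: path_sorted il.
  - move=> j jl; have /allP := order_path_min ltn_trans il.
    by apply; rewrite map_f.
move=> hT; have [|||k'] := @H (enum 'I_K.+1) [set u] 0.
- move=> v'; rewrite inE => /eqP ->; exists [::]; split => //.
    by rewrite /temporal_path /= eqxx.
  by move=> x; rewrite !inE.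
- by rewrite val_enum_ord iota_ltn_sorted.
- by move=> i _.
by rewrite hT => /(_ v); rewrite inE => /(_ isT)[s []]; exists s.
Qed.

End Reached.

(** Labels along a temporal path are sorted, so a first edge that is not early and a last edge that
    is not late confine the whole path to the middle third. *)
Lemma connected_all_mid_paths M (c : R -> 'I_(3 * M).+3) G f :
  coarsening c G f -> temporally_connected G -> all_mid_paths f.
Proof.
move=> [c_homo edgeP labelP] tc; apply/forallP => u; apply/forallP => v.
apply/implyP => /and3P[uv /forall_inP hu /forall_inP hv].
have [s /and4P[us /eqP ls es ss]] := tc u v uv.
case/lastP: s us ls es ss => [|s v']; first by move=> _ /= vu; rewrite vu eqxx in uv.
rewrite last_rcons => us v'v; rewrite {}v'v in us *.
set PE := path_edges u (rcons s v) => /allP es ss.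
have {}es e : e \in PE -> exists2 x : vpair n, val x = e & f x = Some (c (tlabel G e)).
  move=> ePE; have /eqP e2 := path_edges_card2 us ePE.
  exists (Sub e e2) => //; have := es e ePE.
  rewrite -[X in X \in _](SubK (vpair n) e2) edgeP.
  by case fe : (f _) => [i|] // _; rewrite -(labelP _ _ fe) SubK.
have low e : e \in PE -> (M.+1 <= c (tlabel G e))%N.
  pose e1 := [set u; head v s].
  have [r PEr] : exists r, PE = e1 :: r.
    by rewrite /PE /e1; case: (s) => [|y s']; [exists [::]|eexists].
  move=> ePE; apply: (@leq_trans (c (tlabel G e1))).
    have [|x xe fx] := es e1; first by rewrite PEr mem_head.
    have := hu x; rewrite !inE xe !inE eqxx fx => /(_ isT); lia.
  apply: c_homo; move: ss ePE; rewrite PEr /= => /(order_path_min le_trans)/allP h.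
  by rewrite inE => /orP[/eqP -> //|er]; apply: h; rewrite map_f.
have high e : e \in PE -> (c (tlabel G e) < 2 * M.+1)%N.
  pose e1 := [set last u s; v].
  have PEr : PE = rcons (path_edges u s) e1 by rewrite /PE path_edges_rcons.
  move=> ePE; apply: (@leq_ltn_trans (c (tlabel G e1))).
    apply: c_homo; move: ss ePE; rewrite PEr map_rcons.
    rewrite sorted_pairwise ?pairwise_rcons; last exact: le_trans.
    move=> /andP[/allP h _]; rewrite mem_rcons inE => /orP[/eqP -> //|er].
    by apply: h; rewrite map_f.
  have [|x xe fx] := es e1; first by rewrite PEr mem_rcons mem_head.
  have := hv x; rewrite !inE xe !inE eqxx orbT fx => /(_ isT); lia.
(* The path has [size s + 2] distinct vertices. *)
have sn : (size s < n)%N.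
  have /card_uniqP := us; rewrite /= size_rcons => us'.
  by have := max_card (mem (u :: rcons s v)); rewrite us' card_ord; lia.
(* Cells are shifted to start at the middle third; [low] and [high] ensure that neither the
   subtraction nor [inord] truncates. *)
pose t : seq 'I_M.+1 := [seq inord (c (tlabel G e) - M.+1) | e <- PE].
have szt : size t == (size s).+1 by rewrite size_map size_pairmap size_rcons.
apply/existsP; exists (Ordinal sn); apply/existsP; exists (in_tuple s).
apply/existsP; exists (Tuple szt); rewrite us /=; apply/andP; split.
  have -> : [seq val i | i <- t] =
      [seq (c x - M.+1)%N | x <- [seq tlabel G e | e <- PE]].
    rewrite /t -!map_comp; apply/eq_in_map => e ePE /=; rewrite inordK//.
    by have := high e ePE; lia.
  apply: homo_sorted ss => x y /c_homo xy; lia.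
rewrite /states -/PE /t -map_comp; apply/eqP/eq_in_map => e ePE /=.
have [x xe fx] := es e ePE; rewrite -xe valK /= fx xe; congr (Some (Some _)).
apply: val_inj; rewrite /mid_cell /= !inordK//;
  by have := low e ePE; have := high e ePE; lia.
Qed.

End Coarsening.

From mathcomp Require Import all_classical all_reals all_analysis.

Import numFieldNormedType.Exports.

Local Open Scope classical_set_scope.

(** * Equal cells of the unit interval under the uniform law *)

Section Cells.
Context (R : realType) (K : nat).

(** The minimum sends label 1 and everything beyond it to the last cell, so that the map is monotone
    on the whole line. *)
Definition cell (x : R) : 'I_K.+1 := inord (minn K (Num.truncn (x * K.+1%:R))).

Lemma val_cell x : cell x = minn K (Num.truncn (x * K.+1%:R)) :> nat.
Proof. by rewrite inordK// ltnS geq_minl. Qed.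

Lemma cell_homo x y : x <= y -> (cell x <= cell y)%N.
Proof.
move=> xy; rewrite !val_cell leq_min geq_minl /= geq_min; apply/orP; right.
by apply: Num.Theory.le_truncn; rewrite ler_wpM2r.
Qed.

Lemma uniform_probE (U : set (measurableTypeR R)) : measurable U ->
  uniform_prob (@ltr01 R) U = lebesgue_measure (U `&` `[0, 1]).
Proof.
move=> mU; rewrite /uniform_prob integral_uniform_pdf.
rewrite (eq_integral (fun=> 1%:E)); last first.
  move=> x; rewrite inE /= => -[_]; rewrite in_itv /= /uniform_pdf => ->.
  by rewrite subr0 invr1.
by rewrite integral_cst ?mul1e//; exact: measurableI.
Qed.

(** Half-open intervals, except that the last one is closed at 1. *)
Definition cell_itv (i : 'I_K.+1) : interval R :=
  Interval (BLeft (i%:R / K.+1%:R))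
    (if (i < K)%N then BLeft (i.+1%:R / K.+1%:R) else BRight 1).

Lemma cell_preimage (i : 'I_K.+1) :
  [set x | cell x = i] `&` `[0, 1] = [set` cell_itv i].
Proof.
have K0 : 0 < K.+1%:R :> R by rewrite ltr0n.
apply/seteqP; split => x /=.
  move=> [<-]; rewrite in_itv /= => /andP[x0 x1].
  have xK0 : 0 <= x * K.+1%:R by rewrite mulr_ge0.
  rewrite /cell_itv val_cell in_itv /=; apply/andP; split.
    rewrite ler_pdivrMr// -truncn_ge_nat// geq_minr//.
  case: ifPn => // xK.
  have h : minn K (Num.truncn (x * K.+1%:R)) = Num.truncn (x * K.+1%:R) by lia.
  by rewrite h /= ltr_pdivlMr// truncnS_gt.
rewrite /cell_itv in_itv /= => /andP[ix].
rewrite ler_pdivrMr// in ix.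
have xK0 : 0 <= x * K.+1%:R by apply: le_trans ix.
have x0 : 0 <= x by rewrite -(pmulr_lge0 _ K0).
have it : (i <= Num.truncn (x * K.+1%:R))%N by rewrite truncn_ge_nat.
have iK : (i <= K)%N by rewrite -ltnS.
case: ifPn => [iK' /=|iK' /=].
  rewrite ltr_pdivlMr// => xi; split.
    apply: val_inj; rewrite /= val_cell.
    have : (Num.truncn (x * K.+1%:R) < i.+1)%N by rewrite truncn_lt_nat.
    lia.
  rewrite in_itv /= x0 -(ler_pM2r K0) mul1r; apply/ltW/(lt_le_trans xi).
  by rewrite ler_nat.
move=> x1; split; last by rewrite in_itv /= x0.
by apply: val_inj; rewrite /= val_cell; lia.
Qed.

Lemma cell_measurable (i : 'I_K.+1) :
  measurable ([set x | cell x = i] : set (measurableTypeR R)).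
Proof.
pose f (x : R) : R := (cell x)%:R.
have mf : measurable_fun setT f.
  apply: measurable_realfun.nondecreasing_measurable => // x y xy.
  by rewrite ler_nat cell_homo.
rewrite (_ : [set _ | _] = setT `&` f @^-1` [set i%:R]).
  by apply: mf.
rewrite setTI; apply/seteqP; rewrite /f; split => x /= [].
  by move=> ->.
by move=> /eqP; rewrite eqr_nat => /eqP /val_inj.
Qed.

Lemma uniform_cell (i : 'I_K.+1) :
  uniform_prob (@ltr01 R) [set x | cell x = i] = (K.+1%:R^-1)%:E.
Proof.
rewrite uniform_probE; last exact: cell_measurable.
rewrite cell_preimage /cell_itv.
have K0 : 0 < K.+1%:R :> R by rewrite ltr0n.
have iK : (i <= K)%N by rewrite -ltnS.
case: ifPn => iK'; rewrite lebesgue_measure_itv /= lte_fin.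
  rewrite ltr_pM2r ?invr_gt0// ltr_nat ltnSn -EFinB -mulrBl -natrB ?leqnSn//.
  by rewrite subSnn mul1r.
have -> : (i : nat) = K by lia.
rewrite ltr_pdivrMr// mul1r ltr_nat ltnSn -EFinB; congr (_%:E).
by rewrite -[X in X - _](@divff _ K.+1%:R) ?gt_eqF// -mulrBl -natrB// subSnn mul1r.
Qed.

End Cells.

(** * Transfer from the continuous model to the finite one *)

Section Discretization.
Context (R : realType) (n K : nat).

Definition discretize (w : outcome R n) : {ffun vpair n -> option 'I_K.+1} :=
  [ffun e => if tnth w.1 (enum_rank e) then Some (cell K (tnth w.2 (enum_rank e)))
             else None].

Lemma coarsening_discretize w : coarsening (cell K) (random_tgraph w) (discretize w).
Proof.
split=> [||e i]; first exact: cell_homo; last first.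
  by rewrite ffunE /= /outcome_label valK; case: (tnth _ _) => // -[].
move=> e; rewrite ffunE /=; case: (boolP (tnth _ _)) => he /=.
  by apply/imsetP; exists e; rewrite ?inE.
apply/negP => /imsetP[e']; rewrite inE => + /val_inj ee'; rewrite -ee'.
by rewrite (negbTE he).
Qed.

Variable p : R.
Hypothesis p01 : 0 <= p <= 1.

Let edge_box (f : {ffun vpair n -> option 'I_K.+1}) (k : 'I_#|vpair n|) : set bool :=
  [set isSome (f (enum_val k))].

Let label_box (f : {ffun vpair n -> option 'I_K.+1}) (k : 'I_#|vpair n|) :
    set (measurableTypeR R) :=
  if f (enum_val k) is Some i then [set x | cell K x = i] else setT.

Let label_box_measurable f k : measurable (label_box f k).
Proof. by rewrite /label_box; case: (f _) => // i; exact: cell_measurable. Qed.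

(** A fibre is a box: a present pair fixes its coin and the cell of its label, an absent pair fixes
    its coin only. *)
Lemma discretize_fiber f : [set w | discretize w = f] =
  [set t | forall k, edge_box f k (tnth t k)] `*`
  [set t | forall k, label_box f k (tnth t k)].
Proof.
apply/seteqP; split => -[b t] /=.
  move=> <-; split => k; rewrite /edge_box /label_box /= ffunE enum_valK /=;
  by case: (tnth b k).
move=> [hb ht]; apply/ffunP => e; rewrite ffunE /=.
have := hb (enum_rank e); have := ht (enum_rank e).
rewrite /edge_box /label_box /= enum_rankK.
by case: (f e) => [i|] /=; case: (tnth b _) => // ->.
Qed.

Lemma discretize_measurable f : measurable [set w | discretize w = f].
Proof.
rewrite discretize_fiber; apply: measurableX; apply: measurable_box => //.
Qed.

Lemma Fnp_discretize f :
  Fnp n p [set w | discretize w = f] = (weight (fun=> @state_mass R K p) f)%:E.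
Proof.
rewrite discretize_fiber.
transitivity (iid (bernoulli_prob p) #|vpair n|
    [set t | forall k, edge_box f k (tnth t k)] *
  iid (uniform_prob (@ltr01 R)) #|vpair n|
    [set t | forall k, label_box f k (tnth t k)])%E.
  apply: product_measure1E; first exact: measurable_box.
  by apply: measurable_box => k; exact: label_box_measurable.
rewrite !iid_boxE//.
rewrite -big_split /= /weight (reindex (@enum_val _ (vpair n))) /=; last first.
  by apply: onW_bij; exact: enum_val_bij.
rewrite -prodEFin; apply: eq_bigr => k _.
rewrite /edge_box /label_box; case: (f _) => [i|] /=.
  rewrite uniform_cell bernoulli_probE// !diracE [true \in _]mem_set//.
  by rewrite [false \in _]memNset//= mule1 mule0 adde0 -EFinM.
rewrite probability_setT mule1 bernoulli_probE// !diracE.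
by rewrite [true \in _]memNset// [false \in _]mem_set//= mule0 mule1 add0e.
Qed.

(** [E] contains the disjoint union of the fibres over the outcomes that are not bad, whose measures
    are the finite weights. *)
Lemma Fnp_ge (E : set (outcome R n)) (bad : pred {ffun vpair n -> option 'I_K.+1}) :
  measurable E -> (forall w, ~~ bad (discretize w) -> E w) ->
  ((1 - prob (@state_mass R K p) bad)%:E <= Fnp n p E)%E.
Proof.
move=> mE hE.
have -> : 1 - prob (@state_mass R K p) bad =
    \sum_(f | ~~ bad f) weight (fun=> @state_mass R K p) f.
  apply/eqP; rewrite subr_eq; apply/eqP.
  rewrite -[LHS](@expect_cst _ (vpair n) _ (@state_mass R K p)); last first.
    exact: state_mass_sum1.
  rewrite /expect /prob /expect (bigID (fun f => ~~ bad f)) /=; congr (_ + _).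
    by apply: eq_bigr => f _; rewrite mulr1.
  rewrite [RHS](bigID (fun f => ~~ bad f)) /= [X in _ = X + _]big1 ?add0r; last first.
    by move=> f /negbTE ->; rewrite mulr0.
  by apply: eq_bigr => f; rewrite negbK => ->.
rewrite -sumEFin.
under eq_bigr do rewrite -Fnp_discretize.
pose D := [set` (fun f => ~~ bad f)].
have -> : (\sum_(f | ~~ bad f) Fnp n p [set w | discretize w = f] =
   Fnp n p (\bigcup_(f in D) [set w | discretize w = f]))%E.
  rewrite measure_fin_bigcup//.
  - apply: bigfs; first exact: index_enum_uniq.
    by move=> f _; rewrite mem_index_enum.
  - exact: finite_finset.
  - by move=> f g _ _ [w [/= <- <-]].
  - by move=> f _; exact: discretize_measurable.
apply: le_measure; rewrite ?inE//.
  apply: fin_bigcup_measurable => [|f _]; first exact: finite_finset.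
  exact: discretize_measurable.
by move=> w [f /= Df fw]; apply: hE; rewrite fw.
Qed.

End Discretization.

(** * Asymptotics *)

Section FiniteSizeBounds.
Context (R : realType).
Implicit Types (n : nat) (p eps a : R).

(** Union bound over the sources, with [n^3 + 1] cells: fine enough to make [q n^2] at most
    [1 / n]. *)
Lemma Fnp_connected_ge n p eps : (3 <= n)%N -> 0 < eps < 1 -> 0 <= p <= 1 ->
  ((1 - n%:R * (decay n eps (p / (n ^ 3).+1%:R) ^+ (n ^ 3).+1 *
      ((n - 2)%:R ^+ 2 / eps)))%:E <=
    Fnp n p [set w | temporally_connected (random_tgraph w)])%E.
Proof.
move=> n3 eps01 p01; set K := (n ^ 3)%N.
pose ss := [seq Some i | i <- enum 'I_K.+1].
pose bad (f : {ffun vpair n -> option 'I_K.+1}) :=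
  [exists u : 'I_n, explore val [set u]%SET ss f != [set: 'I_n]%SET].
have mu0 s : 0 <= @state_mass R K p s by exact: state_mass_ge0.
have mE := @measurable_temporally_connected R n.
apply: le_trans (@Fnp_ge R n K p p01 _ bad mE _); last first.
  move=> w; rewrite negb_exists => /forallP h u v uv.
  apply: (explore_temporal_path (coarsening_discretize K w)).
  by apply/eqP; have := h u; rewrite negbK.
rewrite lee_fin lerD2l lerN2; apply: le_trans (prob_exists _ _) _ => //.
rewrite mulr_natl -[in leRHS](card_ord n) -sumr_const; apply: ler_sum => u _.
have := @explore_fail R 'I_n (vpair n) _ val (@state_mass R K p) ss
  (p / K.+1%:R) eps u (@card_crossing_vpair n).
rewrite card_ord size_map size_enum_ord; apply => //.
- case/andP: p01 => p0 p1; rewrite divr_ge0//= ler_pdivrMr// mul1r.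
  by apply: le_trans p1 _; rewrite ler1n.
- exact: state_mass_sum1.
- by rewrite map_inj_uniq ?enum_uniq//; exact: Some_inj.
- by move=> s /mapP[i _ ->].
Qed.

Lemma Fnp_disconnected_ge n M p a : (3 <= n)%N -> 0 <= p <= 1 ->
  a = n%:R * (1 - p / 3) ^+ n.-1 -> 4 <= a ->
  ((1 - (8 * (a^-1 + ((1 - p / 3)^-1 - 1))
    + 8 * path_sum n M p / (1 - p / 3) ^+ 3))%:E <=
    Fnp n p [set w | ~ temporally_connected (random_tgraph w)])%E.
Proof.
move=> n3 p01 aE a4.
have mE : measurable [set w : outcome R n | ~ temporally_connected (random_tgraph w)].
  exact: measurableC (@measurable_temporally_connected R n).
apply: le_trans (@Fnp_ge R n (3 * M).+2 p p01 _ (@all_mid_paths n M) mE _); last first.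
  move=> w /negP h tc; apply: h.
  exact: connected_all_mid_paths (coarsening_discretize _ w) tc.
by rewrite lee_fin lerD2l lerN2; exact: prob_all_mid_paths.
Qed.

Lemma decay_expR n p eps : (3 <= n)%N -> 0 < eps < 1 -> 0 <= p <= 1 ->
  decay n eps (p / (n ^ 3).+1%:R) ^+ (n ^ 3).+1 <=
  expR (- (p * n%:R * (1 - 2 / n%:R) * (1 - eps))).
Proof.
move=> n3 /andP[e0 e1] /andP[p0 p1]; set N := (n ^ 3).+1.
set q := p / N%:R.
have N0 : 0 < N%:R :> R by rewrite ltr0n.
have n0 : 0 < n%:R :> R by rewrite ltr0n (leq_trans _ n3).
have q0 : 0 <= q by rewrite divr_ge0.
have q1 : q <= 1.
  by rewrite ler_pdivrMr// mul1r (le_trans p1)// ler1n.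
apply: (@le_trans _ _ (expR (- (q / (1 + q * n%:R ^+ 2) * n.-1%:R * (1 - eps))) ^+ N)).
  apply: lerXn2r; rewrite ?nnegrE ?expR_ge0//; first exact: decay_ge0.
  exact: expR_ge1Dx.
rewrite -expRM_natl ler_expR mulrN lerN2.
have qn : q * n%:R ^+ 2 <= n%:R^-1.
  rewrite -[leRHS]mul1r ler_pdivlMr// (_ : q * n%:R ^+ 2 * n%:R = p * n%:R ^+ 3 / N%:R).
    rewrite ler_pdivrMr// mul1r; apply: (@le_trans _ _ (n%:R ^+ 3)).
      by rewrite ler_piMl// exprn_ge0// ltW.
    by rewrite -natrX ler_nat.
  by rewrite /q; ring.
have -> : N%:R * (q / (1 + q * n%:R ^+ 2) * n.-1%:R * (1 - eps)) =
    p * (n.-1%:R / (1 + q * n%:R ^+ 2)) * (1 - eps).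
  have D0 : 1 + q * n%:R ^+ 2 != 0.
    by rewrite gt_eqF// ltr_pwDl// mulr_ge0 ?exprn_ge0// ltW.
  have -> : N%:R * (q / (1 + q * n%:R ^+ 2) * n.-1%:R * (1 - eps)) =
    (q * N%:R) * (n.-1%:R / (1 + q * n%:R ^+ 2)) * (1 - eps) by ring.
  by rewrite /q divfK// gt_eqF.
apply: ler_wpM2r; first by rewrite subr_ge0 ltW.
rewrite -mulrA; apply: ler_wpM2l => //.
have D0 : 0 < 1 + q * n%:R ^+ 2.
  by rewrite ltr_pwDl// mulr_ge0 ?exprn_ge0// ltW.
(* It remains to see [(n - 2) (1 + q n^2) <= n - 1], which follows from [q n^2 <= 1 / n]. *)
rewrite ler_pdivlMr// mulrBr mulr1.
have -> : n%:R * (2 / n%:R) = 2 :> R by rewrite mulrC divfK// gt_eqF.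
have nE : n%:R = n.-1%:R + 1 :> R by rewrite natr1 prednK// (leq_trans _ n3).
have n20 : 0 <= n%:R - 2 :> R by rewrite subr_ge0 ler_nat ltnW.
have := ler_wpM2l n20 qn; rewrite [X in _ <= X]mulrBl mulfV ?gt_eqF//.
have : 0 < n%:R^-1 :> R by rewrite invr_gt0.
lra.
Qed.

Lemma expR_partial_sum (z : R) m : 0 <= z ->
  \sum_(l < m) z ^+ l / l`!%:R <= expR z.
Proof.
move=> z0; have -> : expR z = limn (series (exp_coeff z)).
  by rewrite expRE /pseries exp_coeffE.
rewrite -(big_mkord xpredT (fun l => z ^+ l / l`!%:R)).
apply: (nondecreasing_cvgn_le _ (is_cvg_series_exp_coeff z)).
by apply: nondecreasing_series => l _ _; exact: exp_coeff_ge0.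
Qed.

Lemma ffact_le_expn (m k : nat) : (m ^_ k <= m ^ k)%N.
Proof.
elim: k => [|k IH]; first by rewrite ffactn0.
by rewrite ffactnSr expnSr leq_mul// leq_subr.
Qed.

(** Since [C(l+1+M, l+1) (l+1)!] is a falling factorial, at most [(n + M + 1)^(l+1)], the sum is
    bounded by [1 / n] times a partial sum of the exponential series at [z]. With [M = n^2], [z]
    exceeds [n p / 3] by at most 1. *)
Lemma path_sum_expR n p : (3 <= n)%N -> 0 <= p <= 1 ->
  path_sum n (n ^ 2) p <= expR (n%:R * p / 3 + 1) / n%:R.
Proof.
move=> n3 /andP[p0 p1]; set M := (n ^ 2)%N.
have n0 : 0 < n%:R :> R by rewrite ltr0n (leq_trans _ n3).
have M0 : 0 < M.+1%:R :> R by rewrite ltr0n.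
have KE : (3 * M).+3%:R = 3 * M.+1%:R :> R.
  by rewrite -natrM mulnS.
set q := p / (3 * M).+3%:R.
have q0 : 0 <= q by rewrite divr_ge0.
pose z := n%:R * q * (n + M.+1)%:R.
have z0 : 0 <= z by rewrite !mulr_ge0.
have zle : z <= n%:R * p / 3 + 1.
  have -> : z = n%:R * p / 3 + p / 3 * (n%:R ^+ 2 / M.+1%:R).
    rewrite /z /q KE natrD; field; rewrite nat1r; exact: lt0r_neq0.
  rewrite lerD2l; apply: mulr_ile1; rewrite ?divr_ge0 ?exprn_ge0//; first by lra.
  by rewrite ler_pdivrMr// mul1r -natrX ler_nat.
apply: (@le_trans _ _ (expR z / n%:R)); last by rewrite ler_pM2r ?invr_gt0// ler_expR.
apply: (@le_trans _ _ ((\sum_(l < n.+1) z ^+ l / l`!%:R) / n%:R)); last first.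
  by rewrite ler_pM2r ?invr_gt0// expR_partial_sum.
rewrite big_ord_recl /= expr0 fact0 divr1 mulrDl mulr_suml.
rewrite -[leLHS]add0r lerD ?divr_ge0//; apply: ler_sum => l _.
have ln := ltn_ord l; rewrite /bump leq0n add1n.
have f0 : 0 < (l.+1)`!%:R :> R by rewrite ltr0n fact_gt0.
rewrite ler_pdivlMr// ler_pdivlMr//.
have -> : n%:R ^+ l * ('C(l.+1 + M, l.+1)%:R * q ^+ l.+1) * n%:R * (l.+1)`!%:R =
    (n%:R * q) ^+ l.+1 * ('C(l.+1 + M, l.+1) * (l.+1)`!)%:R.
  by rewrite [(n%:R * q) ^+ _]exprMn [in X in _ = X * _]exprS natrM; ring.
rewrite /z [leRHS]exprMn; apply: ler_wpM2l; first by rewrite exprn_ge0// mulr_ge0.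
rewrite bin_ffact -natrX ler_nat.
apply: leq_trans (ffact_le_expn _ _) _.
by rewrite leq_exp2r//; lia.
Qed.

(** With [eps = 1 / L] the error is at most [n^3 L exp (- (3L + 3y - 18)) = exp 18 * L exp (- 3y)],
    where [L <= y^2] and [y^3 <= exp (3y)]. *)
Lemma connected_error n p (L y : R) : (3 <= n)%N -> 0 <= p <= 1 ->
  n%:R = expR L -> 2 <= L -> 1 <= y <= L -> L <= y ^+ 2 ->
  3 * L / n%:R + 3 * y / n%:R <= p ->
  n%:R * (decay n L^-1 (p / (n ^ 3).+1%:R) ^+ (n ^ 3).+1 *
      ((n - 2)%:R ^+ 2 / L^-1)) <= expR 18 / y.
Proof.
move=> n3 p01 nE L2 /andP[y1 yL] Ly pn.
have n0 : 0 < n%:R :> R by rewrite ltr0n (leq_trans _ n3).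
have L0 : 0 < L by lra.
have y0 : 0 < y by lra.
have e01 : 0 < L^-1 < 1 by rewrite invr_gt0 L0 invf_lt1//; lra.
have Ln : L / n%:R <= 1.
  rewrite ler_pdivrMr// mul1r nE; have := expR_ge1Dx L; lra.
have pn' : 3 * L + 3 * y <= p * n%:R.
  by rewrite -ler_pdivrMr// mulrDl.
(* The two correction factors cost at most [6 L (2 / n + 1 / L) = 12 L / n + 6 <= 18]. *)
have Ex : 3 * L + 3 * y - 18 <= p * n%:R * (1 - 2 / n%:R) * (1 - L^-1).
  have s0 : 0 <= (2 / n%:R : R) <= 1.
    by rewrite divr_ge0//= ler_pdivrMr// mul1r ler_nat ltnW.
  case/andP: s0 => s0 s1; case/andP: e01 => t0 t1.
  apply: (@le_trans _ _ ((3 * L + 3 * y) * (1 - 2 / n%:R) * (1 - L^-1))); last first.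
    by apply: ler_wpM2r; [lra|apply: ler_wpM2r; [lra|]].
  apply: (@le_trans _ _ ((3 * L + 3 * y) * (1 - 2 / n%:R - L^-1))); last first.
    rewrite -mulrA; apply: ler_wpM2l; first by lra.
    have : 0 <= 2 / n%:R * L^-1 by rewrite mulr_ge0// ltW.
    lra.
  have h : (3 * L + 3 * y) * (2 / n%:R + L^-1) <= 6 * L * (2 / n%:R + L^-1).
    by apply: ler_wpM2r; lra.
  have e : 6 * L * (2 / n%:R + L^-1) = 12 * (L / n%:R) + 6.
    by field; rewrite !gt_eqF.
  lra.
apply: (@le_trans _ _ (n%:R * (expR (- (3 * L + 3 * y - 18)) * (n%:R ^+ 2 * L)))).
  apply: ler_wpM2l; first exact: ltW.
  rewrite invrK; apply: ler_pM.
  - case/andP: e01 => e0 e1; case/andP: p01 => p0 p1; apply: exprn_ge0.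
    apply: decay_ge0; rewrite ?divr_ge0// ler_pdivrMr// mul1r.
    by rewrite (le_trans p1)// ler1n.
  - by rewrite mulr_ge0 ?exprn_ge0// ltW.
  - by apply: le_trans (decay_expR n3 e01 p01) _; rewrite ler_expR lerN2.
  - apply: ler_wpM2r; first exact: ltW.
    by apply: lerXn2r; rewrite ?nnegrE// ler_nat leq_subr.
have -> : n%:R * (expR (- (3 * L + 3 * y - 18)) * (n%:R ^+ 2 * L)) =
    expR (3 * L) * expR (- (3 * L + 3 * y - 18)) * L.
  have -> : expR (3 * L) = n%:R ^+ 3 by rewrite expRM_natl -nE.
  by ring.
rewrite -expRD.
have -> : 3 * L + - (3 * L + 3 * y - 18) = 18 - 3 * y by ring.
rewrite expRD expRN -mulrA; apply: ler_wpM2l; first exact: expR_ge0.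
have y3 : y ^+ 3 <= expR (3 * y).
  have h0 : 0 <= 3 * y by lra.
  have := @expR_ge1Dxn R (3 * y) 2 h0; rewrite exprMn.
  have : 0 <= y ^+ 3 by rewrite exprn_ge0// ltW.
  have -> : 3`!%:R = 6 :> R by [].
  set Y := y ^+ 3; lra.
rewrite mulrC ler_pdivrMr ?expR_gt0// mulrC ler_pdivlMr//.
apply: le_trans y3; rewrite exprSr; apply: ler_wpM2r => //; exact: ltW.
Qed.

(** With [x = p / 3], the hypothesis says [n x <= L - 2y]. Hence [a >= exp (2y - 3)], and [path_sum]
    is at most [exp (n x + 1) / n], so at most [exp (1 - y)]. *)
Lemma disconnected_error n p (L y a : R) : (3 <= n)%N -> 0 <= p <= 1 ->
  n%:R = expR L -> 3 <= y <= L ->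
  p <= 3 * L / n%:R - 6 * y / n%:R ->
  a = n%:R * (1 - p / 3) ^+ n.-1 ->
  4 <= a /\
  8 * (a^-1 + ((1 - p / 3)^-1 - 1)) + 8 * path_sum n (n ^ 2) p / (1 - p / 3) ^+ 3
    <= (32 + 27 * expR 1) / y.
Proof.
move=> n3 p01 nE /andP[y3 yL] pn aE.
have n0 : 0 < n%:R :> R by rewrite ltr0n (leq_trans _ n3).
have L0 : 0 < L by lra.
have y0 : 0 < y by lra.
case/andP: (p01) => p0 p1.
set x := p / 3 in aE *.
have x0 : 0 <= x by rewrite divr_ge0.
have x3 : x <= 1 / 3 by rewrite /x; lra.
have nx : n%:R * x <= L - 2 * y.
  have : p * n%:R <= 3 * L - 6 * y by rewrite -ler_pdivlMr// mulrBl.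
  by rewrite /x; lra.
have L2n : L ^+ 2 / n%:R <= 2.
  rewrite ler_pdivrMr// nE; have := @expR_ge1Dxn R L 1 (ltW L0).
  have -> : 2`!%:R = 2 :> R by [].
  by set Y := L ^+ 2; lra.
have xLn : x <= L / n%:R by rewrite ler_pdivlMr// mulrC; lra.
have r0 : 0 < 1 - x by lra.
have e1 : expR (- (x / (1 - x))) <= 1 - x.
  rewrite expRN -[leRHS]invrK lef_pV2 ?posrE ?expR_gt0 ?invr_gt0//.
  apply: le_trans (expR_ge1Dx _); rewrite le_eqVlt; apply/orP; left; apply/eqP.
  by field; rewrite gt_eqF.
have ae : expR (2 * y - 3) <= a.
  apply: (@le_trans _ _ (n%:R * expR (- (x / (1 - x))) ^+ n.-1)); last first.
    rewrite aE; apply: ler_wpM2l; first exact: ltW.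
    by apply: lerXn2r; rewrite ?nnegrE ?expR_ge0// ltW.
  rewrite -expRM_natl nE -expRD ler_expR.
  (* The constant 3 absorbs [n x^2 <= L^2 / n <= 2] after multiplying by [1 - x >= 2 / 3]. *)
  suff : n.-1%:R * (x / (1 - x)) <= L - 2 * y + 3 by lra.
  rewrite mulrA ler_pdivrMr//.
  have n1E : n.-1%:R = n%:R - 1 :> R.
    have : n%:R = n.-1%:R + 1 :> R by rewrite natr1 prednK// (leq_trans _ n3).
    lra.
  have h1 : n%:R * x * x <= L * (L / n%:R).
    apply: ler_pM => //; first by rewrite mulr_ge0// ltW.
    by lra.
  have h2 : L * (L / n%:R) = L ^+ 2 / n%:R by rewrite mulrA expr2.
  have h3 : n%:R * x * (1 - x) <= (L - 2 * y) * (1 - x) by rewrite ler_wpM2r// ltW.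
  rewrite n1E; move: h3 h1; rewrite h2 => h3 h1; lra.
have ay : y <= a.
  by apply: le_trans ae; apply: le_trans (expR_ge1Dx _); lra.
split.
  by apply: le_trans ae; apply: le_trans (expR_ge1Dx _); lra.
have a0 : 0 < a by lra.
have t1 : a^-1 <= y^-1 by rewrite lef_pV2 ?posrE.
have t2 : (1 - x)^-1 - 1 <= 3 * y^-1.
  have -> : (1 - x)^-1 - 1 = x / (1 - x) by field; rewrite gt_eqF.
  rewrite ler_pdivrMr//.
  (* From [x <= L / n] and [L y <= L^2 <= 2 n]. *)
  have h : x <= 2 * y^-1.
    apply: (le_trans xLn).
    rewrite ler_pdivrMr// mulrAC ler_pdivlMr//.
    apply: (@le_trans _ _ (L ^+ 2)); last by rewrite -ler_pdivrMr.
    by rewrite expr2 ler_wpM2l// ltW.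
  have : 0 < y^-1 by rewrite invr_gt0.
  move: (y^-1) h => Y h Y0.
  have : Y * x <= Y * (1 / 3) by apply: ler_wpM2l => //; exact: ltW.
  lra.
have t3 : path_sum n (n ^ 2) p <= expR 1 * y^-1.
  apply: le_trans (path_sum_expR n3 p01) _.
  rewrite nE -expRN -nE -expRD.
  apply: (@le_trans _ _ (expR (1 - y))).
    by rewrite ler_expR; move: nx; rewrite /x; lra.
  rewrite expRD expRN ler_wpM2l ?expR_ge0// lef_pV2 ?posrE ?expR_gt0//.
  by have := expR_ge1Dx y; lra.
have ps0 : 0 <= path_sum n (n ^ 2) p.
  by apply: sumr_ge0 => l _; rewrite !mulr_ge0 ?exprn_ge0 ?divr_ge0.
have r3 : 8 / (1 - x) ^+ 3 <= 27.
  rewrite ler_pdivrMr ?exprn_gt0//.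
  have : (2 / 3) ^+ 3 <= (1 - x) ^+ 3 by apply: lerXn2r; rewrite ?nnegrE; lra.
  rewrite exprMn exprVn; move: ((1 - x) ^+ 3) => Q; rewrite !exprS !expr0 !mulr1; lra.
have t4 : 8 * path_sum n (n ^ 2) p / (1 - x) ^+ 3 <= 27 * (expR 1 * y^-1).
  rewrite mulrAC; apply: ler_pM => //.
  by rewrite divr_ge0// exprn_ge0// ltW.
have -> : (32 + 27 * expR 1) / y = 8 * (y^-1 + 3 * y^-1) + 27 * (expR 1 * y^-1) by ring.
by apply: lerD => //; apply: ler_wpM2l => //; exact: lerD.
Qed.

End FiniteSizeBounds.

(** * Passage to the limit *)

Section Asymptotics.
Context (R : realType).
Implicit Types (p : nat -> R).

Local Notation L n := (ln (n%:R : R)).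
Local Notation y n := (ln (n%:R : R) `^ (8 / 10)).

Lemma near_ln_ge (A : R) : \forall n \near \oo, A <= L n.
Proof.
near=> n; rewrite -(expRK A) ler_ln ?posrE ?expR_gt0//.
- by near: n; exact: nbhs_infty_ger.
- apply: (@lt_le_trans _ _ (expR A)); first exact: expR_gt0.
  by near: n; exact: nbhs_infty_ger.
Unshelve. all: by end_near. Qed.

(** The second bound holds because twice the exponent is at least 1; the fifth power clears its
    denominator and yields that [y] is negligible against [L]. *)
Lemma lnpow_bounds (l : R) : 1 <= l ->
  [/\ 1 <= l `^ (8 / 10) <= l, l <= (l `^ (8 / 10)) ^+ 2 &
      (l `^ (8 / 10)) ^+ 5 = l ^+ 4].
Proof.
move=> l1; have l0 : 0 <= l by lra.
split.
- apply/andP; split; last by rewrite ler1_powR//; lra.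
  by rewrite -[leLHS](powRr0 l) ler_powR//; lra.
- by rewrite -powR_mulrn ?powR_ge0// -powRrM le1r_powR//; lra.
- rewrite -powR_mulrn ?powR_ge0// -powRrM -powR_mulrn//; congr (_ `^ _).
  by field.
Qed.

Lemma near_lnpow_ge (A : R) : \forall n \near \oo, A <= y n.
Proof.
near=> n; have L1 : 1 <= L n by near: n; exact: near_ln_ge.
have LA : `|A| ^+ 2 <= L n by near: n; exact: near_ln_ge.
have [/andP[y1 _] Ly _] := lnpow_bounds L1.
apply: le_trans (ler_norm A) _; rewrite -(@ler_pXn2r _ 2) ?nnegrE ?normr_ge0//.
  exact: le_trans LA Ly.
exact: powR_ge0.
Unshelve. all: by end_near. Qed.

Lemma near_lnpow_le (c : R) : 0 < c -> \forall n \near \oo, y n <= c * L n.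
Proof.
move=> c0; near=> n; have L1 : 1 <= L n by near: n; exact: near_ln_ge.
have Lc : (c ^+ 5)^-1 <= L n by near: n; exact: near_ln_ge.
have [_ _ yL] := lnpow_bounds L1; have L0 : 0 <= L n by lra.
rewrite -(@ler_pXn2r _ 5) ?nnegrE ?powR_ge0 ?mulr_ge0 ?(ltW c0)//.
rewrite yL exprMn [L n ^+ 5]exprSr mulrCA ler_peMr ?exprn_ge0//.
by rewrite -ler_pdivrMl ?exprn_gt0// mulr1.
Unshelve. all: by end_near. Qed.

Lemma aas_of_error p (Q : forall n, temporal_graph R 'I_n -> Prop) (C : R) :
  (forall n, measurable [set w : outcome R n | Q n (random_tgraph w)]) ->
  (\forall n \near \oo, ((1 - C / y n)%:E <=
     Fnp n (p n) [set w | Q n (random_tgraph w)])%E) ->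
  aas p Q.
Proof.
move=> mQ hQ; rewrite /aas.
apply: (@squeeze_cvge _ _ _ _ (fun n => (1 - C / y n)%:E) _ (fun=> 1%E)).
- near=> n; apply/andP; split; first by near: n; exact: hQ.
  by apply: probability_le1; exact: mQ.
- apply: cvg_EFin; first by near=> n.
  apply/cvgrPdist_le => e e0; near=> n.
  rewrite /= opprB addrCA subrr addr0.
  have y1 : 1 <= y n by near: n; exact: near_lnpow_ge.
  have yC : `|C| / e <= y n by near: n; exact: near_lnpow_ge.
  have y0 : 0 < y n by lra.
  rewrite normrM normfV (gtr0_norm y0) ler_pdivrMr// mulrC.
  by rewrite -ler_pdivrMr.
- exact: cvg_cst.
Unshelve. all: by end_near. Qed.

Lemma near_natr_lnE : \forall n \near \oo, n%:R = expR (L n).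
Proof.
near=> n; rewrite lnK// posrE ltr0n; near: n; exact: nbhs_infty_gt.
Unshelve. all: by end_near. Qed.

Lemma aas_connected p : (forall n, 0 <= p n <= 1) ->
  (\forall n \near \oo, p n > 3 * L n / n%:R + 3 * y n / n%:R) ->
  aas p (fun n G => temporally_connected G).
Proof.
move=> p01 hp; apply: (@aas_of_error _ _ (expR 18)).
  by move=> n; exact: measurable_temporally_connected.
near=> n.
have n3 : (3 <= n)%N by near: n; exact: nbhs_infty_ge.
have L2 : 2 <= L n by near: n; exact: near_ln_ge.
have L1 : 1 <= L n by lra.
have [y1 Ly _] := lnpow_bounds L1.
have L01 : 0 < (L n)^-1 < 1.
  have L0 : 0 < L n by lra.
  by rewrite invr_gt0 L0 invf_lt1//; lra.
apply: le_trans (Fnp_connected_ge n3 L01 (p01 n)).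
rewrite lee_fin lerD2l lerN2; apply: connected_error => //.
  by near: n; exact: near_natr_lnE.
by apply: ltW; near: n; exact: hp.
Unshelve. all: by end_near. Qed.

Lemma aas_disconnected p : (forall n, 0 <= p n <= 1) ->
  (\forall n \near \oo, p n < 3 * L n / n%:R - 6 * y n / n%:R) ->
  aas p (fun n G => ~ temporally_connected G).
Proof.
move=> p01 hp; apply: (@aas_of_error _ _ (32 + 27 * expR 1)).
  by move=> n; apply: measurableC; exact: measurable_temporally_connected.
near=> n.
have n3 : (3 <= n)%N by near: n; exact: nbhs_infty_ge.
have L1 : 1 <= L n by near: n; exact: near_ln_ge.
have [/andP[_ yL] _ _] := lnpow_bounds L1.
have yL3 : 3 <= y n <= L n by rewrite yL andbT; near: n; exact: near_lnpow_ge.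
have nE : n%:R = expR (L n) by near: n; exact: near_natr_lnE.
have pn : p n <= 3 * L n / n%:R - 6 * y n / n%:R by apply: ltW; near: n; exact: hp.
have [a4 err] := disconnected_error n3 (p01 n) nE yL3 pn erefl.
apply: le_trans (Fnp_disconnected_ge (n ^ 2) n3 (p01 n) erefl a4).
by rewrite lee_fin lerD2l lerN2.
Unshelve. all: by end_near. Qed.

Lemma clamp01_itv (x : R) : 0 <= clamp01 x <= 1.
Proof. by rewrite /clamp01 le_max lexx /= ge_max ler01 ge_min lexx. Qed.

Lemma sharp_threshold_connected :
  sharp_threshold (fun n : nat => 3 * L n / n%:R) (fun n G => temporally_connected G).
Proof.
move=> eps eps0; split.
  apply: aas_disconnected => [n|]; first exact: clamp01_itv.
  (* The part [eps / 4] makes [6 y] smaller than [3 eps L]. The part [1 / 4] keeps [3 L - 6 y]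
     positive, as needed when the clamped value is 0. *)
  pose c := Num.min eps 1 / 4.
  have c0 : 0 < c by rewrite divr_gt0// lt_min eps0 ltr01.
  near=> n.
  have n0 : 0 < n%:R :> R by rewrite ltr0n; near: n; exact: nbhs_infty_gt.
  have L1 : 1 <= L n by near: n; exact: near_ln_ge.
  have yc : y n <= c * L n by near: n; exact: near_lnpow_le.
  have c1 : c * L n <= eps / 4 * L n.
    by rewrite ler_pM2r ?ler_pM2r//; [rewrite ge_min lexx|lra].
  have c2 : c * L n <= 1 / 4 * L n.
    by rewrite ler_pM2r ?ler_pM2r//; [rewrite ge_min lexx orbT|lra].
  have eL : 0 < eps * L n by rewrite mulr_gt0//; lra.
  rewrite -mulrBl gt_max; apply/andP; split.
    by rewrite divr_gt0//; lra.
  by rewrite gt_min; apply/orP; right; rewrite mulrA ltr_pM2r ?invr_gt0//; lra.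
apply: aas_connected => [n|]; first exact: clamp01_itv.
have c0 : 0 < eps / 2 by rewrite divr_gt0.
near=> n.
have n0 : 0 < n%:R :> R by rewrite ltr0n; near: n; exact: nbhs_infty_gt.
(* The lower bound must also stay below 1, where the probability is clamped: [3 L + 3 y <= 6 L],
   while [n = exp L >= 1 + L^2 / 2 >= 1 + 13 L / 2]. *)
have L13 : 13 <= L n by near: n; exact: near_ln_ge.
have yc : y n <= eps / 2 * L n by near: n; exact: near_lnpow_le.
have L1 : 1 <= L n by lra.
have [/andP[_ yL] _ _] := lnpow_bounds L1.
have nE : n%:R = expR (L n) by near: n; exact: near_natr_lnE.
have eL : 0 < eps * L n by rewrite mulr_gt0//; lra.
rewrite -mulrDl lt_max; apply/orP; right; rewrite lt_min; apply/andP; split.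
  rewrite ltr_pdivrMr// mul1r [ltRHS]nE.
  have L0 : 0 <= L n by lra.
  have := @expR_ge1Dxn R (L n) 1 L0; have -> : 2`!%:R = 2 :> R by [].
  have : 13 * L n <= L n ^+ 2 by rewrite expr2 ler_wpM2r.
  lra.
by rewrite mulrA ltr_pM2r ?invr_gt0//; lra.
Unshelve. all: by end_near. Qed.

End Asymptotics.

Theorem theorem5p4 (R : realType) :
  sharp_threshold (fun n : nat => 3 * ln n%:R / n%:R : R)
    (fun n G => temporally_connected G) /\
  forall p : nat -> R, (forall n, 0 <= p n <= 1) ->
    ((\forall n \near \oo,
        p n < 3 * ln n%:R / n%:R - 6 * (ln n%:R `^ (8 / 10)) / n%:R) ->
      aas p (fun n G => ~ temporally_connected G)) /\
    ((\forall n \near \oo,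
        p n > 3 * ln n%:R / n%:R + 3 * (ln n%:R `^ (8 / 10)) / n%:R) ->
      aas p (fun n G => temporally_connected G)).
Proof.
split; first exact: sharp_threshold_connected.
by move=> p p01; split; [exact: aas_disconnected|exact: aas_connected].
Qed.
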